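(* There exists a transcendental growth function $\phi(r)=\sum_{i=0}^{\infty}A_i\,r^i$, with $A_i>0$ for all $i\geqslant 0$ and $\lim_{i\to\infty}A_{i+1}/A_i=0$, such that for any entire holomorphic function $F\in\mathcal{H}(\mathbb{C})$ with slow growth $$|F(z)|\leqslant\phi(|z|)\qquad(\forall\, z\in\mathbb{C}),$$ the set $I\subset\mathbb{S}^1$ of hypercyclic directions of $F$ has Hausdorff dimension zero.
   Context: $\mathcal{H}(\mathbb{C})$ is the space of entire holomorphic functions on $\mathbb{C}$ with the topology of uniform convergence on compact sets. For $a\in\mathbb{C}\setminus\{0\}$, the translation operator $\mathsf{T}_a:\mathcal{H}(\mathbb{C})\to\mathcal{H}(\mathbb{C})$ is $f(\bullet)\mapsto f(\bullet+a)$. An element $f$ is hypercyclic for $\mathsf{T}_a$ if the orbit $\{f,\mathsf{T}_a(f),\mathsf{T}_a^{2}(f),\dots\}$ is dense in $\mathcal{H}(\mathbb{C})$. The hypercyclic directions of $F$ are the set $I$ of all $a$ in the unit circle $\mathbb{S}^1\subset\mathbb{C}$ such that $F$ is hypercyclic for $\mathsf{T}_a$ (the empty set is regarded as having Hausdorff dimension zero). *)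

(* Defs.v *)
From HB Require Import structures.
From mathcomp Require Import all_boot all_order all_algebra.
From mathcomp Require Import complex.
From mathcomp Require Import all_classical all_reals all_analysis.
Import numFieldNormedType.Exports.
Import Order.TTheory GRing.Theory Num.Theory.

Set Implicit Arguments.
Unset Strict Implicit.
Unset Printing Implicit Defensive.

Local Open Scope classical_set_scope.
Local Open Scope ring_scope.

(* R[i] packed as a numClosedFieldType: this is what gives it its norm, its
   topology and its structure of normed module over itself; the norm `|z| is
   an element of R[i]. *)
Definition Cplx (R : realType) : numClosedFieldType := R[i].

(* The real-valued modulus. *)
Definition Cmod (R : realType) (z : Cplx R) : R := ComplexField.Normc.normc z.

(* [derivable f z 1] for maps Cplx R -> Cplx R is differentiability with
   respect to the complex variable at z. *)
Definition entire (R : realType) : set {family compact, Cplx R -> Cplx R} :=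
  [set f | forall z : Cplx R, derivable (f : Cplx R -> Cplx R) z 1].

(* H(C): the library's topology on the subtype [set_type A] is the one induced
   by A, here by uniform convergence on compact sets. *)
Definition entire_space (R : realType) : Type := set_type (@entire R).

HB.instance Definition _ (R : realType) := Topological.on (entire_space R).

Definition entire_fun (R : realType) (f : entire_space R) :
  Cplx R -> Cplx R := sval f.
Coercion entire_fun : entire_space >-> Funclass.

Lemma entire_translate (R : realType) (a : Cplx R) (f : entire_space R) :
  entire (fun z : Cplx R => f (z + a)).
Proof.
move=> z; have /set_mem/(_ (z + a)) := svalP f.
rewrite /derivable; set g := (X in cvg (X @ _)) => g_cvg.
set k := (X in cvg (X @ _)); suff -> : k = g by [].
by apply/funext => h; rewrite /k /g /entire_fun /shift /= addrA.
Qed.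

Definition translate (R : realType) (a : Cplx R) (f : entire_space R) :
  entire_space R :=
  exist (fun g => g \in @entire R) (fun z : Cplx R => f (z + a))
    (mem_set (@entire_translate R a f)).

Definition hypercyclic (R : realType) (a : Cplx R) (f : entire_space R) :=
  dense (range (fun n => iter n (translate a) f)).

Definition hypercyclic_directions (R : realType) (f : entire_space R) :
  set (Cplx R) := [set a | Cmod a = 1 /\ hypercyclic a f].

Section hausdorff_dimension.
Variable R : realType.
Implicit Types A U : set (Cplx R).
Local Open Scope ereal_scope.

(* 0 is added so that the empty set has diameter 0 instead of -oo. *)
Definition diameter A : \bar R :=
  ereal_sup (0 |` [set (Cmod (z.1 - z.2))%:E | z in A `*` A]).

Definition delta_covers (delta : R) A : set (nat -> set (Cplx R)) :=
  [set U | A `<=` \bigcup_n U n /\ forall n, diameter (U n) <= delta%:E].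

Definition hausdorff_content (s delta : R) A : \bar R :=
  ereal_inf [set \sum_(n <oo) diameter (U n) `^ s | U in delta_covers delta A].

Definition hausdorff_measure (s : R) A : \bar R :=
  ereal_sup [set hausdorff_content s delta A | delta in [set d : R | (0 < d)%R]].

(* The exponent s = 0 is left out, which does not change the infimum: since
   0 `^ 0 = 1, the above formula is not the counting measure for s = 0. The
   empty set has dimension 0. *)
Definition hausdorff_dim A : \bar R :=
  ereal_inf [set s%:E | s in [set s : R | (0 < s)%R /\ hausdorff_measure s A = 0]].

End hausdorff_dimension.

Definition transcendental_growth (R : realType) (phi : R -> R) :=
  exists A : nat -> R,
    [/\ forall i, 0 < A i,
        A i.+1 / A i @[i --> \oo] --> 0 &
        forall r : R, pseries A r @ \oo --> phi r].

(* Main.v *)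
Require Import Defs.
From mathcomp Require Import all_boot all_order all_algebra.
From mathcomp Require Import complex ring lra zify.
From mathcomp Require Import all_classical all_reals all_analysis.

(** The growth function is phi(r) = sum_i 2^(-i^2) r^i, for which
    log phi(r) = O((log r)^2).  Let F be entire with |F(z)| <= phi(|z|), and put
    w = F(0) + 1.

    Points where F takes the value w are rare.  If f = F - w vanishes at the
    distinct points zeta_1, ..., zeta_n of the disc |z| <= 2^m, then
    f(z)^2 / prod_k (z - zeta_k) is entire, because near a zero zeta of f the
    difference quotient of f(z)^2 / (z - zeta) is the square of that of f.  Its
    modulus at 0 is at most its maximum on an annulus at distance 2 * 2^m from
    the disc, and |f(0)| = 1; this bounds 2^n by the square of the growth of f,
    hence n by a quadratic polynomial in m ([zero_count], a form of the Jensen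
    inequality).

    A hypercyclic direction leads to points where F takes the value w.  If the
    translates F(z + n a) are dense, one of them is close on |z| <= 10 to
    w + k z, with k as large as desired.  By the argument of Hurwitz, F = w at
    some zeta with |zeta - n a| <= 1; the growth bound forces n to be large when
    k is ([hypercyclic_value]).  Then a lies within 2 / |zeta| of
    zeta / |zeta| ([hypercyclic_direction]).

    So the directions lie, for each M, in the union over m >= M of O(m^2) discs
    of radius 4 / 2^m.  As sum_m m^2 2^(-m s) converges for every s > 0, all
    Hausdorff measures of positive exponent vanish ([hausdorff_dim_limsup]).

    The complex analysis rests on one fact, the maximum modulus principle
    ([max_modulus]) for functions that are merely complex differentiable at each
    point.  The form Re f dx - Im f dy is closed in the pointwise sense, so
    the subdivision argument of Goursat gives it a potential Phi ([potential]).
    The difference quotients (Phi(x + h, y) - Phi(x, y)) / h have enough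
    derivatives to be visibly harmonic, and the second derivative test gives
    them a maximum principle; letting h tend to 0 transfers it to Re f, and a
    rotation transfers it to |f|. *)

Import numFieldNormedType.Exports.
Import Order.TTheory GRing.Theory Num.Theory.

Set Implicit Arguments.
Unset Strict Implicit.
Unset Printing Implicit Defensive.

Local Open Scope classical_set_scope.
Local Open Scope ring_scope.

Local Notation Re := complex.Re.
Local Notation Im := complex.Im.

(** * Real functions of one variable *)

Section RealAnalysis.
Variable R : realType.
Implicit Types (f df : R -> R) (a b x y : R).

Lemma mean_value f df a b : a < b ->
    (forall x, a <= x <= b -> is_derive x 1 f (df x)) ->
  exists2 c, a < c < b & f b - f a = df c * (b - a).
Proof.
move=> ab fd; have [x xab||c cab ->] := @MVT _ f df _ _ ab.
- by apply: fd; move: xab; rewrite in_itv/= => /andP[/ltW -> /ltW ->].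
- apply: derivable_within_continuous => x; rewrite in_itv/= => xab.
  by have [] := fd x xab.
by exists c => //; move: cab; rewrite in_itv.
Qed.

Lemma antiderivative (B : R) (u : R -> R) :
    (forall t : R, `|t| <= B -> {for t, continuous u}) ->
  exists P : R -> R, forall t : R, `|t| < B -> is_derive t 1 P (u t).
Proof.
move=> cu; exists (fun x => (\int[lebesgue_measure]_(t in `[(- B), x]) u t)%R).
move=> t tB.
have /andP[Bt tB'] : - B < t < B by rewrite -ltr_norml.
have iu : lebesgue_measure.-integrable `[- B, B] (EFin \o u).
  apply: continuous_compact_integrable; first exact: segment_compact.
  apply: continuous_in_subspaceT => x; rewrite inE/= in_itv/= -ler_norml => xB.
  exact: cu.
have := continuous_FTC1_closed tB' iu Bt (cu _ (ltW tB)).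
move: (fun x => _) => P [dP]; rewrite derive1E => Pt.
exact: DeriveDef.
Qed.

(** The form of the derivative in which error terms can be added up. *)
Lemma deriv_local f x (l : R) : is_derive x 1 f l ->
  forall eps, 0 < eps -> exists2 delta, 0 < delta &
    forall h, `|h| < delta -> `|f (x + h) - f x - l * h| <= eps * `|h|.
Proof.
move=> [] /[swap] <- df eps e0.
have /cvgrPdist_le /(_ _ e0) := df.
rewrite /= => /nbhs_ballP[d /= d0 dH]; exists d => // h hd.
have [->|h0] := eqVneq h 0; first by rewrite addr0 mulr0 !subrr !normr0 mulr0.
have := dH h; rewrite -ball_normE /= sub0r normrN => /(_ hd h0).
have -> : 'D_1 f x = lim ((fun h => h^-1 *: (f (h *: 1 + x) - f x)) @ 0^') by [].
set L := lim _; rewrite /GRing.scale /= mulr1 [h + x]addrC => H.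
have -> : f (x + h) - f x - L * h = - ((L - h^-1 * (f (x + h) - f x)) * h).
  by field.
by rewrite normrN normrM ler_wpM2r.
Qed.

(** If the second derivative were positive at the maximum, the first derivative,
    which vanishes there, would be positive just to the right, and [f] would
    increase. *)
Lemma second_derivative_test f (g : R -> R) (d x a : R) : 0 < d ->
    (forall t : R, `|t - x| < d -> is_derive t 1 f (g t)) ->
    is_derive x 1 g a ->
    (forall t : R, `|t - x| < d -> f t <= f x) ->
  a <= 0.
Proof.
move=> d0 fg ga fmax; rewrite leNgt; apply/negP => a0.
have gx0 : g x = 0.
  have fx : is_derive x 1 f (g x) by apply: fg; rewrite subrr normr0.
  have : is_derive x 1 f 0.
    apply: (@derive1_at_max _ f (x - d) (x + d)).
    - lra.
    - by move=> t; rewrite in_itv/= => tI; have [] := fg t; first by rewrite ltr_distl.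
    - by rewrite in_itv/=; apply/andP; split; lra.
    - by move=> t; rewrite in_itv/= => tI; apply: fmax; rewrite ltr_distl.
  by move=> f0; rewrite -(@derive_val _ _ _ _ _ _ _ fx) (@derive_val _ _ _ _ _ _ _ f0).
have a20 : 0 < a / 2 by lra.
have [e e0 ge] := deriv_local ga a20.
set t := Num.min (d / 2) (e / 2).
have t0 : 0 < t by rewrite lt_min; apply/andP; split; lra.
have td : t <= d / 2 by rewrite ge_min lexx.
have te : t <= e / 2 by rewrite ge_min lexx orbT.
have [|y /andP[xy yt]|c /andP[xc ct] fE] := @mean_value f g x (x + t); first lra.
  by apply: fg; rewrite ltr_norml; apply/andP; split; lra.
have fle : f (x + t) <= f x by apply: fmax; rewrite ltr_norml; apply/andP; split; lra.
have {}fE : f (x + t) - f x = g c * t by rewrite fE; ring.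
have gc : g c <= 0.
  by rewrite -(pmulr_lle0 _ t0); lra.
have := ge (c - x); rewrite gx0 (ger0_norm (_ : 0 <= c - x)); last lra.
have -> : x + (c - x) = c by ring.
move=> /(_ _)/ler_normlP; case=> [|h1 h2]; first lra.
nra.
Qed.

End RealAnalysis.

(** * The Goursat theorem for closed forms in the plane *)

Section Goursat.
Variable R : realType.
Implicit Types (x y w l : R).

Lemma nested_intervals (u v : nat -> R) :
    (forall n, u n <= u n.+1) -> (forall n, v n.+1 <= v n) ->
    (forall n, u n <= v n) ->
  exists x, forall n, u n <= x <= v n.
Proof.
move=> u_ v_ uv.
have leu m n : (m <= n)%N -> u m <= u n.
  by move: m n; apply/nondecreasing_seqP.
have lev m n : (m <= n)%N -> v n <= v m.
  by move: m n; apply/nonincreasing_seqP.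
have ub n : ubound (range u) (v n).
  move=> _ [m _ <-]; apply: (le_trans (leu _ _ (leq_maxl m n))).
  by apply: (le_trans (uv _)); apply: lev; exact: leq_maxr.
exists (sup (range u)) => n; apply/andP; split.
  by apply: ub_le_sup; [exists (v 0%N); exact: ub | exists n].
by apply: ge_sup; [exists (u 0%N), 0%N | exact: ub].
Qed.

Lemma half_power_small (c d : R) : 0 < d -> exists n, c / 2 ^+ n < d.
Proof.
move=> d0; exists (Num.bound `|c / d|); rewrite ltr_pdivrMr ?exprn_gt0//.
rewrite mulrC -ltr_pdivrMr//; apply: (le_lt_trans (ler_norm _)).
apply: (lt_le_trans (archi_boundP (normr_ge0 _))).
by rewrite -natrX ler_nat; exact/ltnW/ltn_expl.
Qed.

Lemma norm_lt_between (a b B t : R) : - B < a -> b < B -> a <= t <= b -> `|t| < B.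
Proof.
move=> Ba bB /andP[at_ tb].
by rewrite ltr_norml (lt_le_trans Ba at_) (le_lt_trans tb bB).
Qed.

Lemma norm_sub_between (a w s t : R) :
  a <= s <= a + w -> a <= t <= a + w -> `|s - t| <= w.
Proof. by move=> *; rewrite ler_norml; lra. Qed.

(** Differentiability at [(x, y)] of the coefficients of the form p dx + q dy;
    the shared entry [b] says that dp/dy = dq/dx, that is, the form is closed. *)
Definition linear_approx (p q : R -> R -> R) x y a b c :=
  forall eps, 0 < eps -> exists2 d, 0 < d & forall h k, `|h| < d -> `|k| < d ->
    `|p (x + h) (y + k) - p x y - (a * h + b * k)| <= eps * (`|h| + `|k|) /\
    `|q (x + h) (y + k) - q x y - (b * h + c * k)| <= eps * (`|h| + `|k|).

Definition closed_form_at (p q : R -> R -> R) x y :=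
  exists a b c, linear_approx p q x y a b c.

Variables (B : R) (p q P Q : R -> R -> R).
Hypothesis pq_closed : forall x y, `|x| < B -> `|y| < B -> closed_form_at p q x y.
Hypothesis dP : forall x y, `|x| < B -> `|y| < B -> is_derive x 1 (P y) (p x y).
Hypothesis dQ : forall x y, `|x| < B -> `|y| < B -> is_derive y 1 (Q x) (q x y).

(** The integral of p dx + q dy along the boundary of the rectangle with lower
    left corner [(x, y)], width [w] and height [l]; [P y] and [Q x] stand for
    antiderivatives along the horizontal and vertical lines, so that integrals
    over adjacent segments add up by construction. *)
Definition circulation x y w l :=
  (P y (x + w) - P y x) - (P (y + l) (x + w) - P (y + l) x)
  + (Q (x + w) (y + l) - Q (x + w) y) - (Q x (y + l) - Q x y).

Let inside x y w l := [/\ - B < x, x + w < B, - B < y & y + l < B].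

(** The affine part of a closed form has circulation 0 around a rectangle
    containing the point, and the remainder is small compared to the diameter on
    a boundary whose length is comparable to it. *)
Lemma circulation_small x y : `|x| < B -> `|y| < B ->
  forall eps, 0 < eps -> exists2 d, 0 < d & forall x0 y0 w l,
    0 < w -> 0 < l -> w + l < d -> inside x0 y0 w l ->
    x0 <= x <= x0 + w -> y0 <= y <= y0 + l ->
    `|circulation x0 y0 w l| <= eps * (w + l) ^+ 2.
Proof.
move=> xB yB eps e0; have [a [b [c abc]]] := pq_closed xB yB.
have [|d d0 dH] := abc (eps / 2); first lra.
exists d => // x0 y0 w l w0 l0 wld [Bx xwB By ylB] x_in y_in.
have xw : x0 < x0 + w by rewrite ltrDl.
have yl : y0 < y0 + l by rewrite ltrDl.
have [t t_in|s s_in Ps] := @mean_value _ (P y0 \- P (y0 + l))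
    (fun t => p t y0 - p t (y0 + l)) x0 (x0 + w) xw.
  by apply: is_deriveB; apply: dP; rewrite ?(norm_lt_between Bx xwB t_in)//;
    apply: (norm_lt_between By ylB); rewrite ?lexx (ltW yl).
have [t t_in|t t_in Qt] := @mean_value _ (Q (x0 + w) \- Q x0)
    (fun t => q (x0 + w) t - q x0 t) y0 (y0 + l) yl.
  by apply: is_deriveB; apply: dQ; rewrite ?(norm_lt_between By ylB t_in)//;
    apply: (norm_lt_between Bx xwB); rewrite ?lexx (ltW xw).
have {}s_in : x0 <= s <= x0 + w by case/andP: s_in => /ltW -> /ltW ->.
have {}t_in : y0 <= t <= y0 + l by case/andP: t_in => /ltW -> /ltW ->.
have -> : circulation x0 y0 w l =
    (p s y0 - p s (y0 + l)) * w + (q (x0 + w) t - q x0 t) * l.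
  move: Ps Qt; rewrite /circulation /=.
  have -> : x0 + w - x0 = w by rewrite addrAC subrr add0r.
  have -> : y0 + l - y0 = l by rewrite addrAC subrr add0r.
  by move=> <- <-; ring.
have E h k : x0 <= h <= x0 + w -> y0 <= k <= y0 + l ->
    `|p h k - p x y - (a * (h - x) + b * (k - y))| <= eps / 2 * (w + l) /\
    `|q h k - q x y - (b * (h - x) + c * (k - y))| <= eps / 2 * (w + l).
  move=> h_in k_in.
  have hw := norm_sub_between h_in x_in; have kl := norm_sub_between k_in y_in.
  have hk := lerD hw kl.
  have hd : `|h - x| < d.
    by apply: le_lt_trans wld; apply: le_trans hk; rewrite lerDl.
  have kd : `|k - y| < d.
    by apply: le_lt_trans wld; apply: le_trans hk; rewrite lerDr.
  have := dH _ _ hd kd; rewrite ![_ + (_ - _)]addrC !subrK => -[h1' h2'].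
  by split; [apply: (le_trans h1')|apply: (le_trans h2')];
    rewrite ler_wpM2l// ltW// divr_gt0.
have yy0 : y0 <= y0 <= y0 + l by rewrite lexx ltW.
have yy1 : y0 <= y0 + l <= y0 + l by rewrite lexx ltW.
have xx0 : x0 <= x0 <= x0 + w by rewrite lexx ltW.
have xx1 : x0 <= x0 + w <= x0 + w by rewrite lexx ltW.
have {yy0}[u0 _] := E s y0 s_in yy0; have {yy1}[u1 _] := E _ _ s_in yy1.
have {xx0}[_ v0] := E x0 t xx0 t_in; have {xx1}[_ v1] := E _ _ xx1 t_in.
set X := p s y0 - p s (y0 + l); set Y := q (x0 + w) t - q x0 t.
have -> : X * w + Y * l = (X + b * l) * w + (Y - b * w) * l by ring.
have -> : eps * (w + l) ^+ 2 = eps * (w + l) * w + eps * (w + l) * l by ring.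
have epsE : eps * (w + l) = eps / 2 * (w + l) + eps / 2 * (w + l) by field.
apply: le_trans (ler_normD _ _) _; rewrite !normrM (gtr0_norm w0) (gtr0_norm l0).
apply: lerD; rewrite ler_pM2r//.
  have -> : X + b * l = (p s y0 - p x y - (a * (s - x) + b * (y0 - y)))
      - (p s (y0 + l) - p x y - (a * (s - x) + b * (y0 + l - y))).
    by rewrite /X; ring.
  by apply: le_trans (ler_normB _ _) _; rewrite epsE lerD.
have -> : Y - b * w = (q (x0 + w) t - q x y - (b * (x0 + w - x) + c * (t - y)))
    - (q x0 t - q x y - (b * (x0 - x) + c * (t - y))).
  by rewrite /Y; ring.
by apply: le_trans (ler_normB _ _) _; rewrite epsE lerD.
Qed.

Lemma circulation_quarter x y w l : circulation x y w l =
  circulation x y (w / 2) (l / 2) + circulation (x + w / 2) y (w / 2) (l / 2)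
  + circulation x (y + l / 2) (w / 2) (l / 2)
  + circulation (x + w / 2) (y + l / 2) (w / 2) (l / 2).
Proof.
rewrite /circulation.
have -> : x + w / 2 + w / 2 = x + w by field.
have -> : y + l / 2 + l / 2 = y + l by field.
ring.
Qed.

(** A circulation that is too large for its rectangle; the bound scales by 1/4
    under halving, like the number of pieces, so the property is inherited by
    one of the quarters. *)
Let large eta w l (z : R * R) := eta * (w + l) ^+ 2 < `|circulation z.1 z.2 w l|.


Lemma large_quarter eta w l z : large eta w l z -> 0 < w -> 0 < l ->
  exists z' : R * R, [/\ large eta (w / 2) (l / 2) z',
    z.1 <= z'.1, z'.1 + w / 2 <= z.1 + w,
    z.2 <= z'.2 & z'.2 + l / 2 <= z.2 + l].
Proof.
case: z => x y; rewrite /large /= => zlarge w0 l0.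
have E : eta * (w / 2 + l / 2) ^+ 2 = (eta * (w + l) ^+ 2) / 4 by field.
rewrite E; set e := eta * _ in zlarge *.
have [h1|h1] := ltP (e / 4) `|circulation x y (w / 2) (l / 2)|.
  by exists (x, y); split => //=; lra.
have [h2|h2] := ltP (e / 4) `|circulation (x + w / 2) y (w / 2) (l / 2)|.
  by exists (x + w / 2, y); split => //=; lra.
have [h3|h3] := ltP (e / 4) `|circulation x (y + l / 2) (w / 2) (l / 2)|.
  by exists (x, y + l / 2); split => //=; lra.
have [h4|h4] :=
    ltP (e / 4) `|circulation (x + w / 2) (y + l / 2) (w / 2) (l / 2)|.
  by exists (x + w / 2, y + l / 2); split => //=; lra.
move: zlarge; rewrite circulation_quarter ltNge => /negP[].
apply: le_trans (ler_normD _ _) _; apply: le_trans (lerD (ler_normD _ _) (lexx _)) _.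
apply: le_trans (lerD (lerD (ler_normD _ _) (lexx _)) (lexx _)) _; lra.
Qed.

(** Repeated quartering of a rectangle with nonzero circulation gives nested
    rectangles with large circulation, which contradicts [circulation_small] at
    their common point. *)
Lemma goursat_pos x y w l : inside x y w l -> 0 < w -> 0 < l ->
  circulation x y w l = 0.
Proof.
move=> [Bx xwB By ylB] w0 l0; apply/eqP/contraT; rewrite -normr_gt0 => C0.
have wl0 : 0 < w + l by lra.
pose eta := `|circulation x y w l| / (w + l) ^+ 2 / 2.
have wl20 : 0 < (w + l) ^+ 2 by rewrite exprn_gt0.
have eta0 : 0 < eta by rewrite /eta !divr_gt0.
have large0 : large eta w l (x, y).
  have : eta * (w + l) ^+ 2 = `|circulation x y w l| / 2.
    by rewrite /eta; field; rewrite gt_eqF.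
  by rewrite /large /= => ->; lra.
have wn0 n : 0 < w / 2 ^+ n by rewrite divr_gt0 ?exprn_gt0.
have ln0 n : 0 < l / 2 ^+ n by rewrite divr_gt0 ?exprn_gt0.
have halfS (v : R) n : v / 2 ^+ n.+1 = v / 2 ^+ n / 2.
  by rewrite exprSr invfM mulrA.
have step (nz : nat * (R * R)) : exists z', let: (n, z) := nz in
    large eta (w / 2 ^+ n) (l / 2 ^+ n) z ->
    [/\ large eta (w / 2 ^+ n.+1) (l / 2 ^+ n.+1) z',
    z.1 <= z'.1, z'.1 + w / 2 ^+ n.+1 <= z.1 + w / 2 ^+ n,
    z.2 <= z'.2 & z'.2 + l / 2 ^+ n.+1 <= z.2 + l / 2 ^+ n].
  case: nz => n z; have [zlarge|nlarge] := pselect (large eta (w / 2 ^+ n) (l / 2 ^+ n) z).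
    by have [z' z'P] := large_quarter zlarge (wn0 n) (ln0 n); exists z'; rewrite !halfS.
  by exists z.
have [next nextP] := choice step.
pose z_ := fix z_ n := if n is m.+1 then next (m, z_ m) else (x, y).
have z_large n : large eta (w / 2 ^+ n) (l / 2 ^+ n) (z_ n).
  elim: n => [|n IH]; first by rewrite expr0 !divr1.
  by case: (nextP (n, z_ n) IH).
have z_step n := nextP (n, z_ n) (z_large n).
have [xs xsP] : exists xs, forall n, (z_ n).1 <= xs <= (z_ n).1 + w / 2 ^+ n.
  apply: nested_intervals => n; [by case: (z_step n) | by case: (z_step n) |].
  by rewrite lerDl; exact: ltW.
have [ys ysP] : exists ys, forall n, (z_ n).2 <= ys <= (z_ n).2 + l / 2 ^+ n.
  apply: nested_intervals => n; [by case: (z_step n) | by case: (z_step n) |].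
  by rewrite lerDl; exact: ltW.
have z_in n : [/\ x <= (z_ n).1, (z_ n).1 + w / 2 ^+ n <= x + w,
    y <= (z_ n).2 & (z_ n).2 + l / 2 ^+ n <= y + l].
  elim: n => [|n [i1 i2 i3 i4]]; first by rewrite /= !expr0 !divr1.
  have [_ /= s1 s2 s3 s4] := z_step n.
  by split; [exact: le_trans s1|exact: le_trans s2 _|exact: le_trans s3
            |exact: le_trans s4 _].
have xsB : `|xs| < B.
  by apply: (norm_lt_between Bx xwB); have := xsP 0%N; rewrite /= expr0 divr1.
have ysB : `|ys| < B.
  by apply: (norm_lt_between By ylB); have := ysP 0%N; rewrite /= expr0 divr1.
have [d d0 dH] := circulation_small xsB ysB eta0.
have [n nd] := half_power_small (w + l) d0.
have [i1 i2 i3 i4] := z_in n.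
have := dH (z_ n).1 (z_ n).2 _ _ (wn0 n) (ln0 n).
rewrite -mulrDl => /(_ nd _ (xsP n) (ysP n)).
have := z_large n; rewrite /large -mulrDl ltNge => /negP nle H.
case: nle; apply: H; split.
- exact: lt_le_trans i1.
- exact: le_lt_trans xwB.
- exact: lt_le_trans i3.
- exact: le_lt_trans ylB.
Qed.

Lemma goursat x0 x1 y0 y1 :
    `|x0| < B -> `|x1| < B -> `|y0| < B -> `|y1| < B ->
  (P y0 x1 - P y0 x0) - (P y1 x1 - P y1 x0)
  + (Q x1 y1 - Q x1 y0) - (Q x0 y1 - Q x0 y0) = 0.
Proof.
wlog x01 : x0 x1 / x0 <= x1.
  move=> H b0 b1 b2 b3; have [|/ltW] := leP x0 x1; first by move=> ?; apply: H.
  by move=> /H/(_ b1 b0 b2 b3); lra.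
wlog y01 : y0 y1 / y0 <= y1.
  move=> H b0 b1 b2 b3; have [|/ltW] := leP y0 y1; first by move=> ?; apply: H.
  by move=> /H/(_ b0 b1 b3 b2); lra.
move=> b0 b1 c0 c1; have [<-|x01'] := eqVneq x0 x1; first by ring.
have [<-|y01'] := eqVneq y0 y1; first by ring.
have := @goursat_pos x0 y0 (x1 - x0) (y1 - y0).
rewrite /circulation (addrC x0) (addrC y0) !subrK; apply;
  rewrite ?subr_gt0 ?lt_neqAle ?x01' ?y01'//.
move: b0 b1 c0 c1; rewrite !ltr_norml.
move=> /andP[? _] /andP[_ ?] /andP[? _] /andP[_ ?].
by split; rewrite ?(addrC x0) ?(addrC y0) ?subrK.
Qed.

End Goursat.

(** * Potentials of closed forms *)

Section Potential.
Variable R : realType.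
Implicit Types (p q : R -> R -> R) (x y : R).

Lemma closed_form_at_near p q x y : closed_form_at p q x y ->
  exists2 M, 0 < M & exists2 d, 0 < d & forall h k, `|h| < d -> `|k| < d ->
    `|p (x + h) (y + k) - p x y| <= M * (`|h| + `|k|) /\
    `|q (x + h) (y + k) - q x y| <= M * (`|h| + `|k|).
Proof.
move=> [a [b [c /(_ 1 ltr01)[d d0 dH]]]].
have M0 : 0 <= `|a| + `|b| + `|c| by rewrite !addr_ge0.
exists (1 + (`|a| + `|b| + `|c|)); first by rewrite ltr_pwDl.
exists d => // h k hd kd; have [ph qh] := dH h k hd kd.
have lin (u v : R) : `|u| <= `|a| + `|b| + `|c| -> `|v| <= `|a| + `|b| + `|c| ->
    `|u * h + v * k| <= (`|a| + `|b| + `|c|) * (`|h| + `|k|).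
  move=> uM vM; apply: le_trans (ler_normD _ _) _.
  by rewrite mulrDr !normrM lerD// ler_wpM2r.
have aM : `|a| <= `|a| + `|b| + `|c| by rewrite -addrA lerDl addr_ge0.
have bM : `|b| <= `|a| + `|b| + `|c| by rewrite addrAC lerDr addr_ge0.
have cM : `|c| <= `|a| + `|b| + `|c| by rewrite lerDr addr_ge0.
split.
  have -> : p (x + h) (y + k) - p x y =
    p (x + h) (y + k) - p x y - (a * h + b * k) + (a * h + b * k) by ring.
  by apply: le_trans (ler_normD _ _) _; rewrite [leRHS]mulrDl lerD// lin.
have -> : q (x + h) (y + k) - q x y =
  q (x + h) (y + k) - q x y - (b * h + c * k) + (b * h + c * k) by ring.
by apply: le_trans (ler_normD _ _) _; rewrite [leRHS]mulrDl lerD// lin.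
Qed.

Lemma lipschitz_at_continuous (f : R -> R) x (M d : R) : 0 < M -> 0 < d ->
    (forall h, `|h| < d -> `|f (x + h) - f x| <= M * `|h|) ->
  {for x, continuous f}.
Proof.
move=> M0 d0 fM; apply/cvgrPdist_le => e e0.
near=> t; have -> : t = x + (t - x) by rewrite addrC subrK.
rewrite distrC; apply: le_trans (fM _ _) _.
  by rewrite distrC; near: t; exact: cvgr_dist_lt.
rewrite mulrC -ler_pdivlMr// distrC; near: t.
by apply: cvgr_dist_le => //; rewrite divr_gt0.
Unshelve. all: by end_near. Qed.

Lemma closed_form_at_continuous p q x y : closed_form_at p q x y ->
  {for x, continuous (p ^~ y)} /\ {for y, continuous (q x)}.
Proof.
move=> /closed_form_at_near[M M0 [d d0 dH]].
split; apply: (@lipschitz_at_continuous _ _ M d) => // h hd.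
  have [|+ _] := dH h 0 hd; first by rewrite normr0.
  by rewrite normr0 !addr0.
have [|_ +] := dH 0 h _ hd; first by rewrite normr0.
by rewrite normr0 addr0 add0r.
Qed.

(** Integrating from the origin first along the x-axis and then vertically makes
    the y-derivative evident; by the Goursat theorem the other order gives the
    same function, whose x-derivative is evident. *)
Lemma potential p q (B : R) :
    (forall x y, `|x| <= B -> `|y| <= B -> closed_form_at p q x y) ->
  exists Phi : R -> R -> R, forall x y, `|x| < B -> `|y| < B ->
    is_derive x 1 (Phi ^~ y) (p x y) /\ is_derive y 1 (Phi x) (q x y).
Proof.
move=> pq.
have /choice[P dP] y : exists Py : R -> R, `|y| <= B -> forall x, `|x| < B ->
    is_derive x 1 Py (p x y).
  have [yB|yB] := pselect (`|y| <= B); last by exists id.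
  have [Py PyP] := antiderivative (fun x xB => (closed_form_at_continuous (pq x y xB yB)).1).
  by exists Py => _.
have /choice[Q dQ] x : exists Qx : R -> R, `|x| <= B -> forall y, `|y| < B ->
    is_derive y 1 Qx (q x y).
  have [xB|xB] := pselect (`|x| <= B); last by exists id.
  have [Qx QxP] := antiderivative (fun y yB => (closed_form_at_continuous (pq x y xB yB)).2).
  by exists Qx => _.
exists (fun x y => P 0 x - P 0 0 + (Q x y - Q x 0)) => x y xB yB.
have B0 : `|0 : R| < B by rewrite normr0 (le_lt_trans _ xB).
split; last first.
  have dq := dQ x (ltW xB) y yB.
  have := is_deriveD dq (is_derive_cst (P 0 x - P 0 0 - Q x 0) y 1).
  rewrite addr0; congr is_derive; apply/funext => t /=.
  by rewrite /cst [RHS]addrCA.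
have dp := dP y (ltW yB) x xB.
have {}dp : is_derive x 1 (fun t => P y t + (- P y 0 + (Q 0 y - Q 0 0))) (p x y).
  by have := is_deriveD dp (is_derive_cst (- P y 0 + (Q 0 y - Q 0 0)) x 1);
    rewrite addr0.
have pq' (s t : R) : `|s| < B -> `|t| < B -> closed_form_at p q s t.
  by move=> /ltW sB /ltW tB; exact: pq.
have dP' (s t : R) : `|s| < B -> `|t| < B -> is_derive s 1 (P t) (p s t).
  by move=> sB /ltW tB; exact: dP.
have dQ' (s t : R) : `|s| < B -> `|t| < B -> is_derive t 1 (Q s) (q s t).
  by move=> /ltW sB tB; exact: dQ.
apply: near_eq_is_derive dp; near=> t.
have tB : `|t| < B.
  by near: t; apply: cvgr_norm_lt xB; exact: cvg_id.
have := goursat pq' dP' dQ' B0 tB B0 yB.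
lra.
Unshelve. all: by end_near. Qed.

Lemma lipschitz_of_derive (f df : R -> R) (u v r N : R) : `|v - u| < r ->
    (forall t, `|t - u| < r -> is_derive t 1 f (df t) /\ `|df t| <= N) ->
  `|f v - f u| <= N * `|v - u|.
Proof.
move=> vu fN; have [->|] := eqVneq v u; first by rewrite !subrr normr0 mulr0.
have sub t : Num.min u v <= t <= Num.max u v -> `|t - u| < r.
  move: vu; rewrite !ltr_norml minElt maxElt; case: ifP; lra.
rewrite neq_lt => /orP[vu'|uv'].
  have tr t : v <= t <= u -> `|t - u| < r.
    by move: (sub t); rewrite (min_r (ltW vu')) (max_l (ltW vu')).
  have [t tI|t /andP[vt tu] E] := @mean_value _ f df _ _ vu'.
    exact: (fN t (tr _ tI)).1.
  rewrite distrC E normrM [`|v - u|]distrC ler_wpM2r//.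
  by apply: (fN t (tr _ _)).2; rewrite !ltW.
have tr t : u <= t <= v -> `|t - u| < r.
  by move: (sub t); rewrite (min_l (ltW uv')) (max_r (ltW uv')).
have [t tI|t /andP[vt tu] E] := @mean_value _ f df _ _ uv'.
  exact: (fN t (tr _ tI)).1.
rewrite E normrM ler_wpM2r//.
by apply: (fN t (tr _ _)).2; rewrite !ltW.
Qed.

(** Partial derivatives alone do not give joint continuity; here they are bounded
    near each point, so that the mean value theorem applies in each variable. *)
Lemma potential_continuous p q (B : R) (Phi : R -> R -> R) :
    (forall x y, `|x| < B -> `|y| < B -> closed_form_at p q x y) ->
    (forall x y, `|x| < B -> `|y| < B ->
    is_derive x 1 (Phi ^~ y) (p x y) /\ is_derive y 1 (Phi x) (q x y)) ->
  forall x y, `|x| < B -> `|y| < B ->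
  {for (x, y), continuous (fun z => Phi z.1 z.2)}.
Proof.
move=> pq dPhi x y xB yB.
have [M M0 [d d0 dH]] := closed_form_at_near (pq x y xB yB).
pose N := `|p x y| + `|q x y| + M * (d + d).
have N0 : 0 < N by rewrite /N ltr_wpDl ?addr_ge0// mulr_gt0// addr_gt0.
have bnd s t : `|s - x| < d -> `|t - y| < d -> `|p s t| <= N /\ `|q s t| <= N.
  move=> sx ty; have := dH _ _ sx ty; rewrite (addrC x) (addrC y) !subrK.
  have MM : M * (`|s - x| + `|t - y|) <= M * (d + d).
    by rewrite ler_pM2l// lerD// ltW.
  move=> [ph qh]; rewrite /N; split.
    rewrite -[p s t](subrK (p x y)); apply: le_trans (ler_normD _ _) _.
    rewrite addrC -addrA lerD// (le_trans ph)// (le_trans MM)// lerDr//.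
  rewrite -[q s t](subrK (q x y)); apply: le_trans (ler_normD _ _) _.
  by rewrite addrC [`|p x y| + _]addrC -addrA lerD// (le_trans qh)// (le_trans MM)// lerDr.
have near_in (u v : R) (e : R) : `|u| < B -> `|v - u| < B - `|u| -> `|v| < B.
  move=> uB vu; rewrite -[v](subrK u); apply: le_lt_trans (ler_normD _ _) _.
  by rewrite -ltrBrDr.
apply/cvgrPdist_le => e e0.
near=> z; have [z1 z2] : `|z.1 - x| < Num.min d (B - `|x|) /\
    `|z.2 - y| < Num.min d (B - `|y|).
  split.
    rewrite distrC; near: z; apply: cvgr_dist_lt; first exact: cvg_fst.
    by rewrite lt_min d0 subr_gt0.
  rewrite distrC; near: z; apply: cvgr_dist_lt; first exact: cvg_snd.
  by rewrite lt_min d0 subr_gt0.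
have z1x : `|z.1 - x| < d by apply: lt_le_trans z1 _; rewrite ge_min lexx.
have z1B : `|z.1| < B.
  by apply: (near_in x) => //; apply: lt_le_trans z1 _; rewrite ge_min lexx orbT.
have h1 : `|Phi z.1 z.2 - Phi z.1 y| <= N * `|z.2 - y|.
  apply: (@lipschitz_of_derive (Phi z.1) (q z.1)) z2 _ => t.
  rewrite lt_min => /andP[td tB].
  by split; [exact: (dPhi _ _ _ (near_in _ _ _ _ tB)).2|exact: (bnd _ _ _ _).2].
have h2 : `|Phi z.1 y - Phi x y| <= N * `|z.1 - x|.
  apply: (@lipschitz_of_derive (Phi ^~ y) (p ^~ y)) z1 _ => t.
  rewrite lt_min => /andP[td tB].
  split; first exact: (dPhi _ _ (near_in _ _ _ _ tB) _).1.
  by apply: (bnd _ _ _ _).1; rewrite // subrr normr0.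
rewrite /= distrC -[_ - _](subrKA (Phi z.1 y)).
apply: le_trans (ler_normD _ _) _; apply: le_trans (lerD h1 h2) _.
rewrite -mulrDr mulrC -ler_pdivlMr// [leRHS]splitr; apply: lerD; rewrite distrC.
  near: z; apply: cvgr_dist_le; first exact: cvg_snd.
  by rewrite !divr_gt0.
near: z; apply: cvgr_dist_le; first exact: cvg_fst.
by rewrite !divr_gt0.
Unshelve. all: by end_near. Qed.
End Potential.

(** * The maximum principle *)

Section MaximumPrinciple.
Variable R : realType.
Implicit Types (x y : R).

Lemma local_deriv (f : R -> R) x (l : R) :
    (forall eps, 0 < eps -> exists2 delta, 0 < delta &
      forall h, `|h| < delta -> `|f (x + h) - f x - l * h| <= eps * `|h|) ->
  is_derive x 1 f l.
Proof.
move=> H; have fl : (fun h => h^-1 *: (f (h *: 1 + x) - f x)) @ 0^' --> l.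
  apply/cvgrPdist_le => e e0; have [d d0 dH] := H e e0.
  near=> h; have h0 : h != 0 by near: h; exact: nbhs_dnbhs_neq.
  have hd : `|h| < d by near: h; apply: dnbhs0_lt.
  have := dH h hd; rewrite /GRing.scale /= mulr1 [h + x]addrC => fh.
  rewrite distrC -(ler_pM2r (_ : 0 < `|h|)) ?normr_gt0// -normrM.
  by rewrite mulrBl mulrAC mulVf// mul1r.
apply: DeriveDef; first by apply/cvg_ex; exists l.
exact: cvg_lim fl.
Unshelve. all: by end_near. Qed.

Lemma is_derive_shift (f : R -> R) x h l :
  is_derive (x + h) 1 f l -> is_derive x 1 (fun t => f (t + h)) l.
Proof.
move=> df; apply: local_deriv => eps /(deriv_local df)[d d0 dH].
by exists d => // k /dH; rewrite [x + h + k]addrAC.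
Qed.

(** Adding e (x^2 + y^2) to [D] makes its Laplacian positive, which rules out an
    interior maximum by the second derivative test in each variable; then e tends
    to 0. *)
Lemma max_principle_square (D Dx Dy : R -> R -> R) (r M : R) : 0 < r ->
    (forall x y, `|x| <= r -> `|y| <= r ->
      {for (x, y), continuous (fun z => D z.1 z.2)}) ->
    (forall x y, `|x| < r -> `|y| < r ->
      is_derive x 1 (D ^~ y) (Dx x y) /\ is_derive y 1 (D x) (Dy x y)) ->
    (forall x y, `|x| < r -> `|y| < r -> exists c,
      is_derive x 1 (Dx ^~ y) c /\ is_derive y 1 (Dy x) (- c)) ->
    (forall x y, `|x| <= r -> `|y| <= r -> `|x| = r \/ `|y| = r -> D x y <= M) ->
  D 0 0 <= M.
Proof.
move=> r0 cD dD ddD DM; apply/ler_addgt0Pr => e' e'0.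
(* On the square x^2 + y^2 <= 2 r^2, so the perturbation costs at most e'. *)
pose e := e' / (r ^+ 2 *+ 2).
have r20 : 0 < r ^+ 2 *+ 2 by rewrite pmulrn_lgt0// exprn_gt0.
have e0 : 0 < e by rewrite divr_gt0.
pose K : set (R * R) := `[- r, r] `*` `[- r, r].
pose G (z : R * R) := D z.1 z.2 + e * (z.1 ^+ 2 + z.2 ^+ 2).
have KE (z : R * R) : z \in K <-> `|z.1| <= r /\ `|z.2| <= r.
  by rewrite inE /K /= !in_itv/= !ler_norml.
have [|||c cK cmax] := @compact_EVT_max _ R G K.
- by exists (0, 0); split; rewrite /= in_itv/= oppr_le0 ltW.
- by apply: compact_setX; exact: segment_compact.
- apply: continuous_in_subspaceT => z /KE[z1 z2].
  rewrite /continuous_at /G; apply: cvgD.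
    by have := cD _ _ z1 z2; rewrite -surjective_pairing.
  apply: cvgM; first exact: cvg_cst.
  apply: cvgD; rewrite expr2; under eq_fun do rewrite expr2.
    by apply: cvgM; exact: cvg_fst.
  by apply: cvgM; exact: cvg_snd.
move: cK => /KE; case: c cmax => x y /= cmax [xr yr].
have D0 : D 0 0 <= G (x, y).
  have /cmax : (0, 0) \in K by apply/KE; rewrite /= normr0 ltW.
  by rewrite {1}/G /= expr0n/= addr0 mulr0 addr0.
have [bd|] := pselect (`|x| = r \/ `|y| = r).
  apply: (le_trans D0); rewrite /G/= lerD//; first exact: DM.
  rewrite /e mulrAC ler_pdivrMr// ler_pM2l// mulr2n.
  by rewrite -(real_normK (num_real x)) -(real_normK (num_real y)) lerD//
    lerXn2r// nnegrE ltW.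
move=> /not_orP[/eqP xr' /eqP yr'].
have {xr xr'} xr : `|x| < r by rewrite lt_neqAle xr' xr.
have {yr yr'} yr : `|y| < r by rewrite lt_neqAle yr' yr.
have [c [dx dy]] := ddD x y xr yr.
have dsqr (t k : R) : is_derive t 1 (fun t => e * (t ^+ 2 + k)) (e * (2 * t)).
  apply: is_derive_eq; rewrite /GRing.scale /=; ring.
have dlin (t : R) : is_derive t 1 (fun t => e * (2 * t)) (e * 2).
  apply: is_derive_eq; rewrite /GRing.scale /=; ring.
have din (t u : R) : `|u| < r -> `|t - u| < r - `|u| -> `|t| < r.
  move=> ur tu; rewrite -[t](subrK u); apply: le_lt_trans (ler_normD _ _) _.
  by rewrite -ltrBrDr.
have cx : c + e * 2 <= 0.
  apply: (@second_derivative_test _ (fun t => D t y + e * (t ^+ 2 + y ^+ 2))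
     (fun t => Dx t y + e * (2 * t)) (r - `|x|) x).
  - by rewrite subr_gt0.
  - move=> t /(din _ _ xr) tr.
    exact: (is_deriveD (dD t y tr yr).1 (dsqr t (y ^+ 2))).
  - move=> t /(din _ _ xr) tr; apply: (cmax (t, y)).
    by apply/KE; rewrite /= !ltW.
have cy : - c + e * 2 <= 0.
  apply: (@second_derivative_test _ (fun t => D x t + e * (x ^+ 2 + t ^+ 2))
     (fun t => Dy x t + e * (2 * t)) (r - `|y|) y).
  - by rewrite subr_gt0.
  - move=> t /(din _ _ yr) tr.
    have := is_deriveD (dD x t xr tr).2 (dsqr t (x ^+ 2)).
    by congr is_derive; apply/funext => s; rewrite [x ^+ 2 + _]addrC.
  - move=> t /(din _ _ yr) tr; apply: (cmax (x, t)).
    by apply/KE; rewrite /= !ltW.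
by exfalso; clear -e0 cx cy; lra.
Qed.

(** The form p dx + q dy is closed and co-closed: dp/dx + dq/dy = 0. *)
Definition harmonic_form_at (p q : R -> R -> R) x y :=
  exists a b, linear_approx p q x y a b (- a).

Lemma linear_approx_derive p q x y a b c : linear_approx p q x y a b c ->
  is_derive x 1 (p ^~ y) a /\ is_derive y 1 (q x) c.
Proof.
move=> H; split; apply: local_deriv => eps /H[d d0 dH]; exists d => // h hd.
  have [|+ _] := dH h 0 hd; first by rewrite normr0.
  by rewrite normr0 mulr0 !addr0.
have [|_ +] := dH 0 h _ hd; first by rewrite normr0.
by rewrite normr0 mulr0 addr0 !add0r.
Qed.

(** The function [p] has only first derivatives, while the maximum principle
    wants second ones.  Difference quotients of a potential have them, and by the
    mean value theorem they take values of [p] at points shifted by at most 1. *)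
Lemma harmonic_max p q (r M : R) : 0 < r ->
    (forall x y, `|x| <= r + 2 -> `|y| <= r + 2 -> harmonic_form_at p q x y) ->
    (forall x y s, `|x| <= r -> `|y| <= r -> `|x| = r \/ `|y| = r ->
      0 <= s <= 1 -> p (x + s) y <= M) ->
  p 0 0 <= M.
Proof.
move=> r0 har pM; have r2 : r < r + 2 by rewrite ltrDl.
have clo x y : `|x| <= r + 2 -> `|y| <= r + 2 -> closed_form_at p q x y.
  by move=> xr yr; have [a [b ab]] := har x y xr yr; exists a, b, (- a).
have [Phi dPhi] := potential clo.
have inr x : `|x| <= r -> `|x| < r + 2 by move=> /le_lt_trans; apply.
have inrs x s : 0 <= s <= 1 -> `|x| <= r -> `|x + s| < r + 2.
  move=> /andP[s0 s1] xr; apply: le_lt_trans (ler_normD _ _) _.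
  by rewrite (ger0_norm s0) (le_lt_trans (lerD xr s1))// ltrD2l ltr1n.
have cPhi : forall x y, `|x| < r + 2 -> `|y| < r + 2 ->
    {for (x, y), continuous (fun z => Phi z.1 z.2)}.
  by apply: potential_continuous dPhi => x y /ltW xr /ltW yr; exact: clo.
have quotM h : 0 < h -> h <= 1 -> (Phi h 0 - Phi 0 0) / h <= M.
  move=> h0 h1; pose D x y := (Phi (x + h) y - Phi x y) / h.
  have hI : 0 <= h <= 1 by rewrite h1 ltW.
  have -> : (Phi h 0 - Phi 0 0) / h = D 0 0 by rewrite /D add0r.
  apply: (@max_principle_square D (fun x y => (p (x + h) y - p x y) / h)
    (fun x y => (q (x + h) y - q x y) / h) r) => //.
  - move=> x y xr yr; rewrite /D.
    apply: (@continuousM _ _ (fun z : R * R => Phi (z.1 + h) z.2 - Phi z.1 z.2) (fun=> h^-1));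
      last exact: cst_continuous.
    apply: continuousB; last by apply: cPhi; exact: inr.
    apply: (@continuous_comp _ _ _ (fun z : R * R => (z.1 + h, z.2)) (fun z => Phi z.1 z.2)).
      have c1 : z.1 + h @[z --> (x, y)] --> x + h.
        by apply: cvgD; [exact: cvg_fst|exact: cvg_cst].
      have c2 : z.2 @[z --> (x, y)] --> y by exact: cvg_snd.
      exact: cvg_pair c1 c2.
    by apply: cPhi; [exact: inrs|exact: inr].
  - move=> x y /ltW xr /ltW yr.
    have [dx dy] := dPhi x y (inr _ xr) (inr _ yr).
    have [dxh dyh] := dPhi (x + h) y (inrs _ _ hI xr) (inr _ yr).
    split; rewrite /D mulrC.
      have := is_deriveZ h^-1 (is_deriveB (is_derive_shift dxh) dx).
      by congr is_derive; apply/funext => t; rewrite mulrC.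
    have := is_deriveZ h^-1 (is_deriveB dyh dy).
    by congr is_derive; apply/funext => t; rewrite mulrC.
  - move=> x y /ltW xr /ltW yr.
    have [a [b /linear_approx_derive[dx dy]]] := har x y (ltW (inr _ xr)) (ltW (inr _ yr)).
    have [a' [b' /linear_approx_derive[dx' dy']]] :=
      har (x + h) y (ltW (inrs _ _ hI xr)) (ltW (inr _ yr)).
    exists (h^-1 * (a' - a)); split.
      have := is_deriveZ h^-1 (is_deriveB (is_derive_shift dx') dx).
      by congr is_derive; apply/funext => t; rewrite mulrC.
    have := is_deriveZ h^-1 (is_deriveB dy' dy).
    have -> : - (h^-1 * (a' - a)) = h^-1 *: (- a' - - a) by rewrite /GRing.scale /=; ring.
    by congr is_derive; apply/funext => t; rewrite mulrC.
  - move=> x y xr yr bd; rewrite /D.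
    have [|t tI|t /andP[xt th] ->] := @mean_value _ (Phi ^~ y) (p ^~ y) x (x + h).
    + by rewrite ltrDl.
    + have -> : t = x + (t - x) by rewrite addrC subrK.
      refine (dPhi _ _ (inrs _ _ _ xr) (inr _ yr)).1.
      case/andP: tI => xt th.
      by rewrite subr_ge0 xt lerBlDl (le_trans th)// lerD2l.
    have -> : x + h - x = h by rewrite addrAC subrr add0r.
    rewrite mulfK ?gt_eqF//.
    have -> : t = x + (t - x) by rewrite addrC subrK.
    by apply: pM => //; rewrite subr_ge0 (ltW xt) lerBlDl (le_trans (ltW th))// lerD2l.
apply/ler_addgt0Pr => e e0.
have B0 : `|0 : R| < r + 2 by apply: inr; rewrite normr0 ltW.
have [d d0 dH] := deriv_local (dPhi 0 0 B0 B0).1 e0.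
pose h := Num.min (d / 2) 1.
have h0 : 0 < h by rewrite lt_min ltr01 divr_gt0.
have hd : `|h| < d.
  rewrite gtr0_norm// (le_lt_trans (_ : _ <= d / 2)) ?ge_min ?lexx//.
  by rewrite ltr_pdivrMr// mulr_natr mulr2n ltrDl.
have h1 : h <= 1 by rewrite ge_min lexx orbT.
have := dH h hd; rewrite add0r (gtr0_norm h0) => /ler_normlP[H _].
have := quotM h h0 h1; rewrite ler_pdivrMr// => H2.
rewrite -(ler_pM2r h0) mulrDl; clear -H H2; lra.
Qed.
End MaximumPrinciple.

(** * Complex differentiable functions *)

Section Modulus.
Variable R : realType.
Implicit Types (z w : Cplx R).

Lemma Cplx_normE z : `|z| = (Cmod z)%:C%C :> Cplx R.
Proof. by []. Qed.

Lemma ltr_realC (a b : R) : ((a%:C%C : Cplx R) < b%:C%C) = (a < b).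
Proof. exact: ltcR. Qed.

Lemma ler_realC (a b : R) : ((a%:C%C : Cplx R) <= b%:C%C) = (a <= b).
Proof. exact: lecR. Qed.

Lemma gt0_realC (e : Cplx R) : 0 < e -> exists2 r : R, 0 < r & e = r%:C%C.
Proof.
case: e => a b; rewrite ltcE /= => /andP[/eqP b0 a0]; exists a => //.
by rewrite b0.
Qed.

Lemma CmodM z w : Cmod (z * w) = Cmod z * Cmod w.
Proof. exact: ComplexField.Normc.normcM. Qed.

Lemma CmodV z : Cmod z^-1 = (Cmod z)^-1.
Proof. exact: ComplexField.Normc.normcV. Qed.

Lemma Cmod0 : Cmod (0 : Cplx R) = 0.
Proof. exact: ComplexField.Normc.normc0. Qed.

Lemma Cmod1 : Cmod (1 : Cplx R) = 1.
Proof. exact: ComplexField.Normc.normc1. Qed.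

Lemma CmodN z : Cmod (- z) = Cmod z.
Proof. exact: normcN. Qed.

Lemma CmodBC z w : Cmod (z - w) = Cmod (w - z).
Proof. by rewrite -CmodN opprB. Qed.

Lemma CmodD z w : Cmod (z + w) <= Cmod z + Cmod w.
Proof. exact: le_normcD. Qed.

Lemma Cmod_ge0 z : 0 <= Cmod z.
Proof. by case: z => a b; exact: sqrtr_ge0. Qed.

Lemma Cmod_eq0 z : (Cmod z == 0) = (z == 0).
Proof.
apply/eqP/eqP => [|->]; last exact: Cmod0.
exact: ComplexField.Normc.eq0_normc.
Qed.

Lemma Cmod_gt0 z : (0 < Cmod z) = (z != 0).
Proof. by rewrite lt_neqAle Cmod_ge0 andbT eq_sym Cmod_eq0. Qed.

Lemma CmodX z n : Cmod (z ^+ n) = Cmod z ^+ n.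
Proof. by elim: n => [|n IH]; rewrite ?expr0 ?Cmod1// !exprS CmodM IH. Qed.

Lemma CmodB_ge z w : Cmod z - Cmod w <= Cmod (z - w).
Proof. by rewrite lerBlDr -{1}(subrK w z) CmodD. Qed.

Lemma Cmod_real (a : R) : Cmod (a%:C%C : Cplx R) = `|a|.
Proof. by rewrite /Cmod /= expr0n /= addr0 sqrtr_sqr. Qed.

Lemma Cmod_nat n : Cmod (n%:R : Cplx R) = n%:R.
Proof.
have -> : (n%:R : Cplx R) = ((n%:R : R)%:C)%C by rewrite rmorph_nat.
by rewrite Cmod_real normr_nat.
Qed.

Lemma Re_le_Cmod z : `|Re z| <= Cmod z.
Proof.
case: z => a b; rewrite /Cmod /= -sqrtr_sqr ler_wsqrtr// lerDl sqr_ge0//.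
Qed.

Lemma Im_le_Cmod z : `|Im z| <= Cmod z.
Proof.
case: z => a b; rewrite /Cmod /= -sqrtr_sqr ler_wsqrtr// lerDr sqr_ge0//.
Qed.

Lemma Cmod_le_ReIm z : Cmod z <= `|Re z| + `|Im z|.
Proof.
case: z => a b; rewrite /Cmod /= -[leRHS]ger0_norm ?addr_ge0// -sqrtr_sqr.
rewrite ler_wsqrtr// sqrrD !real_normK ?num_real// addrAC lerDl.
by rewrite mulrn_wge0// mulr_ge0.
Qed.

End Modulus.

Section ComplexDerivative.
Variable R : realType.
Implicit Types (f g : Cplx R -> Cplx R) (z w d : Cplx R).

Definition has_cderiv f z d := forall eps : R, 0 < eps ->
  exists2 r : R, 0 < r & forall h : Cplx R, Cmod h < r ->
    Cmod (f (z + h) - f z - d * h) <= eps * Cmod h.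

Lemma has_cderivP f z : derivable f z 1 <-> exists d, has_cderiv f z d.
Proof.
split.
  move=> df; have [d /cvgrPdist_le fd] : exists d : Cplx R,
      h^-1 *: (f (h%:A + z) - f z) @[h --> 0^'] --> d by exact/cvg_ex.
  exists d => eps eps0.
  have /fd /nbhs_ballP[_ /= /gt0_realC[r r0 ->] rH] : 0 < (eps%:C%C : Cplx R).
    by rewrite ltr_realC.
  exists r => // h hr; have [->|h0] := eqVneq h 0.
    by rewrite addr0 mulr0 !subrr Cmod0 mulr0.
  have := rH h; rewrite -ball_normE /= sub0r normrN Cplx_normE ltr_realC => /(_ hr h0).
  rewrite Cplx_normE ler_realC /GRing.scale /= mulr1 [h + z]addrC => H.
  have -> : f (z + h) - f z - d * h = - ((d - h^-1 * (f (z + h) - f z)) * h).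
    by field.
  by rewrite CmodN CmodM ler_wpM2r// Cmod_ge0.
move=> [d H]; apply/cvg_ex; exists d.
change (h^-1 *: (f (h%:A + z) - f z) @[h --> 0^'] --> (d : Cplx R)).
apply/cvgrPdist_le => _ /gt0_realC[e e0 ->]; have [r r0 rH] := H e e0.
have r0' : 0 < (r%:C%C : Cplx R) by rewrite ltr_realC.
near=> h; have h0 : h != 0 by near: h; exact: nbhs_dnbhs_neq.
have hd : Cmod h < r by rewrite -ltr_realC -Cplx_normE; near: h; apply: dnbhs0_lt.
have := rH h hd; rewrite /GRing.scale /= mulr1 [h + z]addrC => fh.
rewrite Cplx_normE ler_realC CmodBC -(ler_pM2r (_ : 0 < Cmod h)) ?Cmod_gt0// -CmodM.
by rewrite mulrBl mulrAC mulVf// mul1r.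
Unshelve. all: by end_near. Qed.

(** The Cauchy-Riemann equations. *)
Lemma has_cderiv_harmonic f z d : has_cderiv f z d ->
  harmonic_form_at (fun x y => Re (f (x +i* y)%C)) (fun x y => - Im (f (x +i* y)%C))
    (Re z) (Im z).
Proof.
case: z d => x y [a b] fd; exists a, (- b) => eps eps0 /=.
have [r r0 rH] := fd eps eps0.
exists (r / 2); first by rewrite divr_gt0.
move=> h k hr kr; have hk := Cmod_le_ReIm ((h +i* k)%C : Cplx R).
have /rH : Cmod ((h +i* k)%C : Cplx R) < r.
  by apply: le_lt_trans hk _; rewrite [ltRHS]splitr ltrD.
have -> : ((x +i* y)%C : Cplx R) + (h +i* k)%C = ((x + h) +i* (y + k))%C by [].
set fh := f ((x + h) +i* (y + k))%C; set f0 := f (x +i* y)%C => H.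
have [RE IE] : Re (fh - f0 - (a +i* b)%C * (h +i* k)%C) =
      Re fh - Re f0 - (a * h + - b * k) /\
    Im (fh - f0 - (a +i* b)%C * (h +i* k)%C) =
      - (- Im fh - - Im f0 - (- b * h + - a * k)).
  case: fh {H} => s t; case: f0 => s0 t0 /=.
  by split; ring.
have {}H := le_trans H (ler_wpM2l (ltW eps0) hk).
split; first by rewrite -RE; apply: le_trans (Re_le_Cmod _) _; exact: H.
by rewrite -normrN -IE; apply: le_trans (Im_le_Cmod _) _; exact: H.
Qed.

Lemma derivable_harmonic f x y : derivable f (x +i* y)%C 1 ->
  harmonic_form_at (fun x y => Re (f (x +i* y)%C)) (fun x y => - Im (f (x +i* y)%C)) x y.
Proof. by move=> /has_cderivP[d /has_cderiv_harmonic]. Qed.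

(** A rotation makes [f 0] real and nonnegative, and [harmonic_max] applies to
    the real part.  The annulus contains the boundary of the square of half-side
    [r], together with its horizontal shifts by at most 1. *)
Lemma max_modulus f (r M : R) : 0 < r ->
    (forall z, `|Re z| <= r + 2 -> `|Im z| <= r + 2 -> derivable f z 1) ->
    (forall z, r - 1 <= Cmod z <= 2 * r + 1 -> Cmod (f z) <= M) ->
  Cmod (f 0) <= M.
Proof.
move=> r0 df fM.
have r1 : r - 1 <= Cmod (r%:C%C : Cplx R) <= 2 * r + 1.
  by rewrite Cmod_real gtr0_norm//; apply/andP; split; lra.
have M0 : 0 <= M by apply: le_trans (fM _ r1); exact: Cmod_ge0.
have [->|f0] := eqVneq (f 0) 0; first by rewrite Cmod0.
have Cf0 : Cmod (f 0) != 0 by rewrite Cmod_eq0.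
(* The rotation that makes the value at the origin real and nonnegative. *)
pose c : Cplx R := `|f 0| / f 0.
have c1 : Cmod c = 1.
  by rewrite /c Cplx_normE CmodM CmodV Cmod_real ger0_norm ?Cmod_ge0// divff.
pose g z := c * f z.
have -> : Cmod (f 0) = Re (g 0) by rewrite /g /c divfK.
apply: (@harmonic_max R (fun x y => Re (g (x +i* y)%C))
  (fun x y => - Im (g (x +i* y)%C)) r M) => //.
  move=> x y xr yr; apply: derivable_harmonic; apply: derivableM.
    exact: derivable_cst.
  exact: df.
move=> x y s xr yr bd /andP[s0 s1]; apply: (le_trans (ler_norm _)).
apply: (le_trans (Re_le_Cmod _)); rewrite CmodM c1 mul1r; apply: fM.
pose zs : Cplx R := ((x + s) +i* y)%C.
have h1 : `|x + s| <= Cmod zs := Re_le_Cmod zs.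
have h2 : `|y| <= Cmod zs := Im_le_Cmod zs.
have h3 : Cmod zs <= `|x + s| + `|y| := Cmod_le_ReIm zs.
rewrite -/zs; move: (Cmod zs) h1 h2 h3 => C h1 h2 h3.
have h4 : `|x + s| <= `|x| + 1.
  by apply: le_trans (ler_normD _ _) _; rewrite lerD2l ger0_norm.
have h5 : `|x| - 1 <= `|x + s|.
  rewrite lerBlDr -{1}(addrK s x); apply: le_trans (ler_normB _ _) _.
  by rewrite lerD2l ger0_norm.
by clear -h1 h2 h3 h4 h5 xr yr bd; apply/andP; split; [case: bd => bd|]; lra.
Qed.

(** The difference quotient at [z] is the square of that of [f]; the value of
    the quotient at [z] itself is 0, because [0^-1 = 0]. *)
Lemma derivable_square_div f z : derivable f z 1 -> f z = 0 ->
  derivable (fun w => f w ^+ 2 / (w - z)) z 1.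
Proof.
move=> df fz; have [d fd] : exists d : Cplx R,
    h^-1 *: (f (h%:A + z) - f z) @[h --> 0^'] --> d by exact/cvg_ex.
apply/cvg_ex; exists (d * d).
pose q (h : Cplx R) := h^-1 *: (f (h%:A + z) - f z).
suff E : (fun h : Cplx R =>
    h^-1 *: (f (h%:A + z) ^+ 2 / (h%:A + z - z) - f z ^+ 2 / (z - z))) =
    (fun h => q h * q h).
  change ((fun h : Cplx R =>
    h^-1 *: (f (h%:A + z) ^+ 2 / (h%:A + z - z) - f z ^+ 2 / (z - z))) @ 0^'
    --> (d * d : Cplx R)).
  by rewrite E; exact: (cvgM fd fd).
clear -fz; apply/funext => h; rewrite /q /GRing.scale /= mulr1 fz.
rewrite subrr invr0 mulr0 !subr0 addrK.
by ring.
Qed.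

Lemma derivable_mul f g z : derivable f z 1 -> derivable g z 1 ->
  derivable (fun w => f w * g w) z 1.
Proof. exact: derivableM. Qed.

Lemma derivable_inv f z : f z != 0 -> derivable f z 1 ->
  derivable (fun w => (f w)^-1) z 1.
Proof. exact: derivableV. Qed.

Lemma derivable_prod_sub (s : seq (Cplx R)) z :
  derivable (fun w => \prod_(a <- s) (w - a)) z 1.
Proof.
elim: s => [|a s IH].
  have -> : (fun w : Cplx R => \prod_(a <- [::]) (w - a)) = cst 1.
    by apply/funext => w; rewrite big_nil.
  exact: derivable_cst.
have -> : (fun w : Cplx R => \prod_(b <- a :: s) (w - b)) =
    (fun w => (w - a) * \prod_(b <- s) (w - b)).
  by apply/funext => w; rewrite big_cons.
have dlin : derivable (fun w : Cplx R => w - a) z 1.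
  exact: (derivableB (@derivable_id _ _ z 1) (@derivable_cst _ _ _ a z 1)).
exact (derivable_mul dlin IH).
Qed.

(** One square suffices for all the zeros, because they are distinct: near each
    of them the other factors are invertible. *)
Lemma derivable_square_div_zeros f (s : seq (Cplx R)) : uniq s ->
    (forall z, derivable f z 1) -> (forall z, z \in s -> f z = 0) ->
  forall z, derivable (fun w => f w ^+ 2 / \prod_(a <- s) (w - a)) z 1.
Proof.
move=> us df sf z.
have prod0 (r : seq (Cplx R)) : z \notin r -> \prod_(a <- r) (z - a) != 0.
  move=> zr; rewrite prodf_seq_neq0; apply/allP => a ar /=; rewrite subr_eq0.
  by apply: contraNneq zr => ->.
have [zs|zs] := boolP (z \in s); last first.
  exact (derivable_mul (derivable_mul (df z) (df z))
    (derivable_inv (prod0 _ zs) (@derivable_prod_sub s z))).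
have -> : (fun w => f w ^+ 2 / \prod_(a <- s) (w - a)) =
    (fun w => (f w ^+ 2 / (w - z)) * (\prod_(a <- rem z s) (w - a))^-1).
  by apply/funext => w; rewrite (big_rem z)//= invfM mulrA.
have zrem : z \notin rem z s by rewrite mem_rem_uniq// inE eqxx.
exact (derivable_mul (derivable_square_div (df z) (sf z zs))
  (derivable_inv (prod0 _ zrem) (@derivable_prod_sub (rem z s) z))).
Qed.
End ComplexDerivative.

(** * A growth function and the rarity of zeros *)

Section Growth.
Variable R : realType.

(** The coefficients 2^(-i^2) give log phi(r) = O((log r)^2): fast enough decay
    for the zeros to be counted by a polynomial in log r. *)
Definition slow_coef (i : nat) : R := (2 ^+ (i ^ 2))^-1.

Lemma slow_coef_gt0 i : 0 < slow_coef i.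
Proof. by rewrite invr_gt0 exprn_gt0. Qed.

Lemma slow_coef_ratio : slow_coef i.+1 / slow_coef i @[i --> \oo] --> 0.
Proof.
have -> : (fun i => slow_coef i.+1 / slow_coef i) = geometric 2^-1 (4^-1).
  apply/funext => i; rewrite /slow_coef /geometric /= invrK.
  have -> : (i.+1 ^ 2 = i ^ 2 + (2 * i + 1))%N by nia.
  rewrite exprD invfM mulrAC mulVf ?mul1r ?expf_neq0//.
  by rewrite exprD expr1 exprM invfM -exprVn mulrC; congr (_ * _^-1 ^+ _); ring.
apply: cvg_geometric; rewrite gtr0_norm ?invr_gt0//.
by rewrite invf_lt1// ltr1n.
Qed.

(** Because i m - i^2 <= m^2 - i. *)
Lemma slow_coef_bound (m i : nat) (r : R) : (0 < m)%N -> `|r| <= 2 ^+ m ->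
  `|slow_coef i * r ^+ i| <= geometric (2 ^+ (m ^ 2)) 2^-1 i.
Proof.
move=> m0 rm; rewrite normrM normrX gtr0_norm ?slow_coef_gt0// /slow_coef /=.
rewrite ler_pdivrMl ?exprn_gt0// exprVn mulrCA mulrA -exprD.
rewrite ler_pdivlMr ?exprn_gt0//.
apply: (@le_trans _ _ ((2 ^+ m) ^+ i * 2 ^+ i)).
  by rewrite ler_pM2r ?exprn_gt0// lerXn2r// nnegrE.
rewrite -exprM -exprD ler_eXn2l ?ltr1n//.
have [im|mi] := leqP i m; last by nia.
have [->|i0] := posnP i; first by nia.
nia.
Qed.

Definition slow_growth (r : R) : R := limn (pseries slow_coef r).

Lemma slow_growth_cvg (r : R) : pseries slow_coef r @ \oo --> slow_growth r.
Proof.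
have [m rm] : exists m, (0 < m)%N /\ `|r| <= 2 ^+ m.
  exists (Num.bound `|r|).+1; split => //.
  apply: (le_trans (ltW (archi_boundP (normr_ge0 r)))).
  by rewrite -natrX ler_nat (leq_trans _ (ltnW (ltn_expl _ _)))// ltnW.
have : cvgn (series (fun i => slow_coef i * r ^+ i)); last by [].
apply: normed_cvg.
apply: (series_le_cvg _ _ (fun i => slow_coef_bound i rm.1 rm.2)) => [i|i|].
- exact: normr_ge0.
- by rewrite /geometric /= mulr_ge0// exprn_ge0.
- by apply: is_cvg_geometric_series; rewrite gtr0_norm ?invr_gt0// invf_lt1// ltr1n.
Qed.

Lemma slow_growth0 : slow_growth 0 = 1.
Proof.
apply: cvg_lim => //; rewrite -(cvg_shiftS (pseries slow_coef 0)).
rewrite (_ : (fun n => _) = cst 1); first exact: cvg_cst.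
apply/funext => n; rewrite /pseries /series /= big_nat_recl// expr0 mulr1.
rewrite /slow_coef expr0 invr1 big1 ?addr0// => i _.
by rewrite expr0n /= mulr0.
Qed.

Lemma slow_growth_le (m : nat) (r : R) : (0 < m)%N -> `|r| <= 2 ^+ m ->
  slow_growth r <= 2 ^+ (m ^ 2).+1.
Proof.
move=> m0 rm; have half1 : `|2^-1 : R| < 1.
  by rewrite gtr0_norm ?invr_gt0// invf_lt1// ltr1n.
have cg := @cvg_geometric_series _ (2 ^+ (m ^ 2)) _ half1.
have -> : (2 : R) ^+ (m ^ 2).+1 = 2 ^+ (m ^ 2) * (1 - 2^-1)^-1.
  by rewrite exprSr; congr (_ * _); field.
rewrite -(cvg_lim _ cg)//; apply: ler_lim.
- by apply/cvg_ex; exists (slow_growth r); exact: slow_growth_cvg.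
- by apply/cvg_ex; eexists; exact: cg.
- apply: nearW => n; apply: ler_sum => i _.
  exact: le_trans (ler_norm _) (slow_coef_bound _ m0 rm).
Qed.

End Growth.

Section ZeroCount.
Variable R : realType.
Implicit Types (F : Cplx R -> Cplx R) (z w : Cplx R).

Lemma Cmod_prod_le (s : seq (Cplx R)) z (c : R) : 0 <= c ->
    (forall a, a \in s -> Cmod (z - a) <= c) ->
  Cmod (\prod_(a <- s) (z - a)) <= c ^+ size s.
Proof.
move=> c0; elim: s => [|a s IH] sc; first by rewrite big_nil Cmod1.
rewrite big_cons CmodM exprS ler_pM ?Cmod_ge0 ?sc ?mem_head//.
by apply: IH => b bs; rewrite sc// inE bs orbT.
Qed.

Lemma Cmod_prod_ge (s : seq (Cplx R)) z (c : R) : 0 <= c ->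
    (forall a, a \in s -> c <= Cmod (z - a)) ->
  c ^+ size s <= Cmod (\prod_(a <- s) (z - a)).
Proof.
move=> c0; elim: s => [|a s IH] sc; first by rewrite big_nil Cmod1.
rewrite big_cons CmodM exprS ler_pM ?exprn_ge0 ?sc ?mem_head//.
by apply: IH => b bs; rewrite sc// inE bs orbT.
Qed.

(** Division by the product over the zeros gains a factor 2 for each of them:
    |z - a| is at most 2^m at the origin, and at least 2 * 2^m on the annulus
    3 * 2^m <= |z|, where |f|^2 is bounded by the growth. *)
Lemma zero_count F (s : seq (Cplx R)) (m : nat) : (0 < m)%N ->
    (forall z, derivable F z 1) ->
    (forall z, Cmod (F z) <= slow_growth (Cmod z)) ->
    uniq s -> (forall z, z \in s -> F z = F 0 + 1) ->
    (forall z, z \in s -> Cmod z <= 2 ^+ m) ->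
  (size s <= 2 * (m + 3) ^ 2 + 4)%N.
Proof.
move=> m0 dF Fphi us sF sm; pose f z := F z - (F 0 + 1).
have df z : derivable f z 1.
  exact: (derivableB (dF z) (@derivable_cst _ _ _ (F 0 + 1) z 1)).
have sf z : z \in s -> f z = 0 by move=> /sF Fz; rewrite /f Fz subrr.
have f0 : f 0 = -1 by rewrite /f; ring.
have dG := derivable_square_div_zeros us df sf.
pose P : R := 2 ^+ m.
have P2 : 2 <= P by rewrite /P -{1}[2]expr1 ler_eXn2l ?ltr1n.
pose K : R := 2 ^+ ((m + 3) ^ 2 + 2).
have fK z : Cmod z <= 8 * P -> Cmod (f z) <= K.
  move=> zP; apply: le_trans (CmodD _ _) _; rewrite CmodN.
  have h1 : Cmod (F z) <= 2 ^+ ((m + 3) ^ 2).+1.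
    apply: le_trans (Fphi z) _; apply: slow_growth_le; first by rewrite addnS.
    by rewrite ger0_norm ?Cmod_ge0// exprD mulrC (_ : 2 ^+ 3 = 8)// -natrX.
  have h2 : Cmod (F 0 + 1) <= 2.
    apply: le_trans (CmodD _ _) _; rewrite Cmod1.
    by have := Fphi 0; rewrite Cmod0 slow_growth0; lra.
  have h3 : 2 <= (2 : R) ^+ ((m + 3) ^ 2).+1.
    by rewrite -{1}[2]expr1 ler_eXn2l ?ltr1n.
  rewrite /K addn2 [leRHS]exprS; lra.
have K0 : 0 <= K by rewrite exprn_ge0.
have := @max_modulus _ (fun w => f w ^+ 2 / \prod_(a <- s) (w - a)) (3 * P + 1)
  (K ^+ 2 / (2 * P) ^+ size s).
rewrite f0 => /(_ _ (fun z _ _ => dG z) _) H.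
have {}H : Cmod ((-1) ^+ 2 / \prod_(a <- s) (0 - a)) <= K ^+ 2 / (2 * P) ^+ size s.
  apply: H; first lra.
  move=> z /andP[z1 z2]; rewrite CmodM CmodV CmodX.
  have fz : Cmod (f z) <= K by apply: fK; lra.
  apply: ler_pM; rewrite ?exprn_ge0 ?invr_ge0 ?Cmod_ge0//.
    by rewrite lerXn2r// nnegrE Cmod_ge0.
  have P20 : 0 < (2 * P) ^+ size s by rewrite exprn_gt0//; lra.
  have prodP : (2 * P) ^+ size s <= Cmod (\prod_(a <- s) (z - a)).
    apply: Cmod_prod_ge => [|a /sm am]; first lra.
    by apply: le_trans (CmodB_ge _ _); rewrite -/P in am; lra.
  by rewrite lef_pV2// posrE (lt_le_trans P20).
move: H; rewrite sqrrN expr1n mul1r CmodV.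
have prodle : Cmod (\prod_(a <- s) (0 - a)) <= P ^+ size s.
  apply: Cmod_prod_le => [|a /sm am]; first lra.
  by rewrite sub0r CmodN.
have prodgt : 0 < Cmod (\prod_(a <- s) (0 - a)).
  rewrite Cmod_gt0 prodf_seq_neq0; apply/allP => a /sf fa /=.
  rewrite sub0r oppr_eq0; apply/eqP => a0; move: fa; rewrite a0 f0 => /eqP.
  by rewrite oppr_eq0 oner_eq0.
have P0 : 0 < P by lra.
have Pn0 : 0 < P ^+ size s by rewrite exprn_gt0.
move=> H; have {}H : (P ^+ size s)^-1 <= K ^+ 2 / (2 * P) ^+ size s.
  by apply: le_trans H; rewrite lef_pV2 ?posrE.
have : 2 ^+ size s <= K ^+ 2.
  have Q0 : 0 < (2 * P) ^+ size s by rewrite exprn_gt0//; lra.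
  by move: H; rewrite ler_pdivlMr// exprMn mulrC mulfK// gt_eqF.
by rewrite /K -exprM ler_eXn2l ?ltr1n// => /leq_trans; apply; lia.
Qed.
End ZeroCount.

(** * Hypercyclic directions *)

Section Hypercyclic.
Variable R : realType.
Implicit Types (F : entire_space R) (a z w : Cplx R).

Lemma complex_continuous : continuous (fun p : R * R => (p.1 +i* p.2)%C : Cplx R).
Proof.
move=> p; apply/cvgrPdist_le => _ /gt0_realC[e e0 ->].
near=> q; rewrite Cplx_normE ler_realC.
have E : ((p.1 +i* p.2)%C : Cplx R) - (q.1 +i* q.2)%C = ((p.1 - q.1) +i* (p.2 - q.2))%C by [].
rewrite E; apply: le_trans (Cmod_le_ReIm _) _ => /=.
rewrite [leRHS]splitr; apply: lerD; near: q.
  by apply: cvgr_dist_le; [exact: cvg_fst|rewrite divr_gt0].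
by apply: cvgr_dist_le; [exact: cvg_snd|rewrite divr_gt0].
Unshelve. all: by end_near. Qed.

Definition closed_square (r : R) : set (Cplx R) :=
  (fun p : R * R => (p.1 +i* p.2)%C : Cplx R) @` (`[- r, r] `*` `[- r, r]).

Lemma closed_square_compact r : compact (closed_square r).
Proof.
apply: continuous_compact; first exact/continuous_subspaceT/complex_continuous.
by apply: compact_setX; exact: segment_compact.
Qed.

Lemma closed_square_disc r z : Cmod z <= r -> closed_square r z.
Proof.
move=> zr; exists (Re z, Im z); last by case: z zr.
split; rewrite /= in_itv/= -ler_norml (le_trans _ zr)//.
  exact: Re_le_Cmod.
exact: Im_le_Cmod.
Qed.

Lemma entire_derivable F z : derivable F z 1.
Proof. by have /set_mem := svalP F; apply. Qed.

Lemma iter_translate a F n z : iter n (translate a) F z = F (z + n%:R * a).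
Proof.
elim: n z => [|n IH] z; first by rewrite mul0r addr0.
rewrite iterS; have -> : translate a (iter n (translate a) F) z =
  iter n (translate a) F (z + a) by [].
by rewrite IH -addrA -[in RHS]natr1 mulrDl mul1r [_ + a]addrC.
Qed.

(** The maps that are uniformly close to [T] on a compact square containing the
    disc form a neighbourhood of [T]. *)
Lemma hypercyclic_approx a F (T : entire_space R) (r eps : R) :
    hypercyclic a F -> 0 < eps ->
  exists n, forall z, Cmod z <= r -> Cmod (F (z + n%:R * a) - T z) < eps.
Proof.
move=> Fa eps0.
pose N : set (entire_space R) := [set g : entire_space R | forall z, closed_square r z ->
  Cmod (T z - g z) < eps].
have TN : nbhs T N.
  have e0 : 0 < (eps%:C%C : Cplx R) by rewrite ltr_realC.
  have entE : entourage [set xy : Cplx R * Cplx R | ball xy.1 (eps%:C%C : Cplx R) xy.2].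
    exact: (@entourage_ball _ (Cplx R) (PosNum e0)).
  have famN := fam_nbhs (sval T : {family compact, Cplx R -> Cplx R}) entE
    (@closed_square_compact r).
  have valT : {for T, continuous
      (set_val : entire_space R -> {family compact, Cplx R -> Cplx R})}.
    exact: initial_continuous.
  apply: (@filterS _ (nbhs T) _ _ N _ (valT _ famN)).
  by move=> g gN z /gN; rewrite -ball_normE /= Cplx_normE ltr_realC.
have [V [oV VT] VN] : exists2 V : set (entire_space R), open V /\ V T & V `<=` N.
  by move: TN; rewrite nbhsE => -[V [oV VT] VN]; exists V.
have [g [/VN gN [n _ gE]]] := Fa V (ex_intro _ T VT) oV.
exists n => z /closed_square_disc/gN; rewrite -gE iter_translate.
by rewrite CmodBC.
Qed.

Lemma linear_entire w (k : R) : entire (fun z : Cplx R => w + k%:C%C * z).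
Proof.
move=> z; apply: (derivableD (@derivable_cst _ _ _ w z 1)).
exact: (derivable_mul (@derivable_cst _ _ _ (k%:C%C : Cplx R) z 1) (@derivable_id _ _ z 1)).
Qed.

(** If [g] had no zero in the unit disc, its inverse would be differentiable near
    the disc; but it is larger than 2 at the origin and at most 2 on the annulus
    1 <= |z| <= 5, against the maximum principle. *)
Lemma hurwitz (g : Cplx R -> Cplx R) (k : R) : 1 <= k ->
    (forall z, derivable g z 1) ->
    (forall z, Cmod z <= 10 -> Cmod (g z - k%:C%C * z) < 1 / 2) ->
  exists2 z, Cmod z <= 1 & g z = 0.
Proof.
move=> k1 dg gk; apply: contrapT => H.
have g_ge z : 1 <= Cmod z <= 10 -> 1 / 2 <= Cmod (g z).
  move=> /andP[z1 /gk gz].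
  have kz : 1 <= Cmod (k%:C%C * z).
    by rewrite CmodM Cmod_real ger0_norm ?(le_trans ler01 k1)// mulr_ege1.
  have := CmodB_ge (k%:C%C * z) (- (g z - k%:C%C * z)).
  rewrite opprK CmodN (addrC (k%:C%C * z)) subrK; lra.
have g0 z : Cmod z <= 10 -> g z != 0.
  move=> z10; apply/eqP => gz; have [z1|/ltW z1] := leP (Cmod z) 1.
    by apply: H; exists z.
  by have := g_ge z; rewrite z1 z10 gz Cmod0 => /(_ isT); lra.
have : Cmod (g 0)^-1 <= 2.
  apply: (@max_modulus R (fun z => (g z)^-1) 2 2) => [|z z1 z2|z /andP[z1 z2]].
  - lra.
  - apply: (derivable_inv _ (dg z)); apply: g0.
    by apply: le_trans (Cmod_le_ReIm z) _; lra.
  - have zz : 1 <= Cmod z <= 10 by apply/andP; split; lra.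
    have h := g_ge z zz; rewrite CmodV -[2]invrK lef_pV2 ?posrE//; lra.
have := gk 0; rewrite Cmod0 mulr0 subr0 => /(_ ltac:(lra)) h.
have := g0 0; rewrite Cmod0 -Cmod_gt0 => /(_ ltac:(lra)) h0.
by rewrite CmodV -[2]invrK lef_pV2 ?posrE//; lra.
Qed.

(** The translate is compared with w + k z: at z = 10 this is larger than any
    value that F can take at 10 + n a with n <= N, hence n exceeds N. *)
Lemma hypercyclic_value a F (N : nat) : Cmod a = 1 ->
    (forall z, Cmod (F z) <= slow_growth (Cmod z)) -> hypercyclic a F ->
  exists z n, [/\ F z = F 0 + 1, N%:R <= Cmod z & Cmod (z - n%:R * a) <= 1].
Proof.
move=> a1 Fphi Fa; set w := F 0 + 1.
have w2 : Cmod w <= 2.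
  apply: le_trans (CmodD _ _) _; rewrite Cmod1.
  by have := Fphi 0; rewrite Cmod0 slow_growth0; lra.
pose m := (N + 10)%N.
(* The bound for [F] on the disc of radius 2^m, which contains 10 + n a for
   n <= N. *)
pose k : R := 2 ^+ (m ^ 2).+1.
have k1 : 1 <= k by rewrite exprn_ege1// ler1n.
pose T : entire_space R := exist (fun g => g \in @entire R) _
  (mem_set (@linear_entire w k)).
have [n nP] := @hypercyclic_approx a F T 10 (1 / 2) Fa ltac:(lra).
pose g z := F (z + n%:R * a) - w.
have dg z : derivable g z 1.
  have dF : derivable (fun z => F (z + n%:R * a)) z 1.
    exact: (@entire_translate R (n%:R * a) F z).
  exact: (derivableB dF (@derivable_cst _ _ _ w z 1)).
have gk z : Cmod z <= 10 -> Cmod (g z - k%:C%C * z) < 1 / 2.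
  by move=> /nP; rewrite /T /g /= opprD addrA.
have [z z1 gz] := hurwitz k1 dg gk.
exists (z + n%:R * a), n; rewrite addrK; split => //.
  by apply/eqP; rewrite -subr_eq0 -/(g z) gz.
have Nn : (N < n)%N.
  rewrite ltnNge; apply/negP => nN.
  have := gk 10; rewrite Cmod_nat => /(_ (lexx _)).
  have Fle : Cmod (F (10 + n%:R * a)) <= k.
    apply: le_trans (Fphi _) _; apply: slow_growth_le; first by rewrite /m addnS.
    rewrite ger0_norm ?Cmod_ge0//; apply: le_trans (CmodD _ _) _.
    rewrite CmodM a1 mulr1 !Cmod_nat -natrD -natrX ler_nat.
    by apply: leq_trans (ltnW (ltn_expl m (ltnSn 1))); rewrite /m; lia.
  have := CmodB_ge (k%:C%C * 10) (- (g 10 - k%:C%C * 10)).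
  rewrite opprK CmodN (addrC (k%:C%C * 10)) subrK CmodM Cmod_real.
  rewrite ger0_norm ?(le_trans ler01 k1)//.
  rewrite Cmod_nat; have := CmodD (F (10 + n%:R * a)) (- w); rewrite CmodN -/(g 10).
  lra.
have := CmodB_ge (n%:R * a) (- z).
rewrite opprK CmodN CmodM a1 mulr1 Cmod_nat (addrC (n%:R * a)).
have : N%:R + 1 <= n%:R :> R by rewrite natr1 ler_nat.
lra.
Qed.

(** Since n and |z| differ by at most 1, the point |z| a is within 1 of n a, and
    so within 2 of z. *)
Lemma hypercyclic_direction a z (n : nat) : Cmod a = 1 -> z != 0 ->
  Cmod (z - n%:R * a) <= 1 -> Cmod (a - z / `|z|) <= 2 / Cmod z.
Proof.
move=> a1 z0 zn; rewrite Cplx_normE; set c := Cmod z.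
have c0 : 0 < c by rewrite Cmod_gt0.
have cC : (c%:C%C : Cplx R) != 0 by rewrite -Cmod_gt0 Cmod_real gtr0_norm.
rewrite ler_pdivlMr//.
have -> : Cmod (a - z / c%:C%C) * c = Cmod (a * (c%:C%C - n%:R) - (z - n%:R * a)).
  rewrite -{2}(gtr0_norm c0) -Cmod_real -CmodM; congr Cmod.
  by field.
apply: le_trans (CmodD _ _) _; rewrite CmodN CmodM a1 mul1r.
have -> : (c%:C%C : Cplx R) - n%:R = (c - n%:R)%:C%C by rewrite rmorphB rmorph_nat.
rewrite Cmod_real.
suff : `|c - n%:R| <= 1 by lra.
have nE : Cmod (n%:R * a) = n%:R by rewrite CmodM a1 mulr1 Cmod_nat.
have h1 := CmodB_ge z (n%:R * a); have h2 := CmodB_ge (n%:R * a) z.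
rewrite CmodBC in h2; rewrite nE -/c in h1 h2.
by rewrite ler_norml; apply/andP; split; lra.
Qed.
End Hypercyclic.

(** * Coverings and Hausdorff dimension *)

Section Covering.
Variable R : realType.
Implicit Types (A U : set (Cplx R)) (a c z : Cplx R).

Lemma linear_le_geometric (c : R) : 1 < c ->
  exists2 C, 0 < C & forall m, (m + 3)%:R <= C * c ^+ m.
Proof.
move=> c1; have d0 : 0 < c - 1 by rewrite subr_gt0.
exists (3 + (c - 1)^-1); first by rewrite addr_gt0// invr_gt0.
elim=> [|m IH]; first by rewrite expr0 mulr1 lerDl invr_ge0 ltW.
set C := 3 + _ in IH *; have C0 : 0 < C by rewrite addr_gt0// invr_gt0.
rewrite addSn -natr1; apply: le_trans (lerD IH (lexx 1)) _.
have -> : C * c ^+ m.+1 = C * c ^+ m + C * (c - 1) * c ^+ m by rewrite exprS; ring.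
rewrite lerD2l; have -> : C * (c - 1) = 3 * (c - 1) + 1.
  by rewrite /C mulrDl mulVf// gt_eqF.
by apply: mulr_ege1; [rewrite lerDr mulr_ge0// ltW|rewrite exprn_ege1// ltW].
Qed.

Local Open Scope ereal_scope.

Lemma diameter_ge0 A : 0 <= diameter A.
Proof. by apply: ereal_sup_ubound; left. Qed.

Lemma diameter_set0 : diameter (set0 : set (Cplx R)) = 0.
Proof.
rewrite /diameter (_ : _ `|` _ = [set 0]) ?ereal_sup1//.
by apply/seteqP; split => [x [//|[z [[]]]]|x ->]; left.
Qed.

Lemma diameter_ball_le A c (r : R) : (0 <= r)%R ->
  (forall a, A a -> (Cmod (a - c) <= r)%R) -> diameter A <= (2 * r)%:E.
Proof.
move=> r0 Ar; apply: ge_ereal_sup => x [->|[[a b] [/= Aa Ab] <-]].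
  by rewrite lee_fin mulr_ge0.
rewrite lee_fin /= (_ : a - b = (a - c) - (b - c))%R; last by ring.
apply: le_trans (CmodD _ _) _; rewrite CmodN mulrDl mul1r.
by apply: lerD; exact: Ar.
Qed.

Lemma nneseries_le_bound (u : nat -> \bar R) (B : \bar R) :
  (forall k, 0 <= u k) -> (forall n, \sum_(0 <= k < n) u k <= B) ->
  \sum_(k <oo) u k <= B.
Proof.
move=> u0 uB; apply: lime_le; first by apply: is_cvg_nneseries => k _ _.
exact: nearW.
Qed.

Lemma nneseries_block_le (u : nat -> \bar R) (N : nat) (B : R) : (0 <= B)%R ->
  (forall j, 0 <= u j) -> (forall j, (j < N)%N -> u j <= B%:E) ->
  (forall j, (N <= j)%N -> u j = 0) -> \sum_(j <oo) u j <= (N%:R * B)%:E.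
Proof.
move=> B0 u0 uB uN; apply: nneseries_le_bound => // n.
have : forall k, \sum_(0 <= j < k) u j <= ((minn k N)%:R * B)%:E.
  elim=> [|k IH]; first by rewrite big_nil min0n mul0r.
  rewrite big_nat_recr//=; have [kN|Nk] := ltnP k N.
    rewrite (minn_idPl kN) -natr1 mulrDl mul1r EFinD.
    by apply: leeD; [rewrite (minn_idPl (ltnW kN)) in IH|exact: uB].
  by rewrite uN// adde0 (minn_idPr (leqW Nk)); rewrite (minn_idPr Nk) in IH.
move=> /(_ n)/le_trans; apply; rewrite lee_fin ler_wpM2r//.
by rewrite ler_nat geq_minr.
Qed.

(** Turns a double family of sets into the sequence of a covering. *)
Lemma nneseries_pairs (e : nat -> nat * nat) (u : nat * nat -> \bar R) :
  set_bij [set: nat] [set: nat * nat] e -> (forall p, 0 <= u p) ->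
  \sum_(k <oo) u (e k) = \sum_(m <oo) \sum_(j <oo) u (m, j).
Proof.
move=> e_bij u0; rewrite nneseries_esumT// -(@reindex_esum _ _ _ setT setT e)//.
have <- : setT `*`` (fun=> setT) = [set: nat * nat] by apply/seteqP; split.
have E := @esum_esum R nat nat setT (fun=> setT) (fun m j => u (m, j))
  (fun _ _ _ _ => u0 _).
rewrite (eq_esum (b := fun k => u (k.1, k.2))); last by move=> [].
rewrite -E nneseries_esumT; last by move=> m; exact: nneseries_ge0.
by apply: eq_esum => m _; rewrite nneseries_esumT.
Qed.

Definition block_size (m : nat) : nat := 2 * (m + 3) ^ 2 + 4.

(** With c = 2^(s/4) the polynomial factor is O(c^(2 m)) and the power is
    a multiple of c^(-4 m). *)
Lemma block_sum_le (s : R) : (0 < s)%R -> exists D q : R,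
  [/\ (0 < D)%R, (0 < q < 1)%R & forall m,
    ((block_size m)%:R * (8 / 2 ^+ m) `^ s <= D * q ^+ m)%R].
Proof.
move=> s0; pose c : R := (2 `^ (s / 4))%R.
have c1 : (1 < c)%R.
  by rewrite /c /powR pnatr_eq0 /= expR_gt1 mulr_gt0 ?divr_gt0// ln_gt0// ltr1n.
have [C C0 CP] := linear_le_geometric c1.
have c0 : (0 < c)%R by rewrite (lt_trans _ c1).
exists (6 * C ^+ 2 * 8 `^ s)%R, (c ^+ 2)^-1%R; split.
- by rewrite !mulr_gt0 ?exprn_gt0 ?powR_gt0.
- by rewrite invr_gt0 exprn_gt0//= invf_lt1 ?exprn_gt0// exprn_egt1.
move=> m; have c4 : (c ^+ 4 = 2 `^ s)%R.
  by rewrite /c -powR_mulrn ?powR_ge0// -powRrM divfK.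
have -> : ((8 / 2 ^+ m) `^ s = 8 `^ s * (c ^+ 4) ^- m)%R.
  rewrite powRM// ?invr_ge0 ?exprn_ge0//; congr (_ * _)%R.
  have -> : ((2 ^+ m)^-1 = 2 `^ (- m%:R) :> R)%R by rewrite powR_invn.
  by rewrite powRAC powR_invn ?powR_ge0// c4.
have bm : ((block_size m)%:R <= 6 * (C * c ^+ m) ^+ 2)%R.
  apply: (@le_trans _ _ (6 * (m + 3)%:R ^+ 2)%R).
    by rewrite -natrX -natrM ler_nat /block_size; nia.
  by rewrite ler_pM2l// lerXn2r ?CP// nnegrE// mulr_ge0 ?exprn_ge0// ltW.
apply: le_trans (ler_wpM2r _ bm) _.
  by rewrite mulr_ge0 ?powR_ge0// invr_ge0 !exprn_ge0// ltW.
rewrite le_eqVlt; apply/orP; left; apply/eqP.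
have cm : (c ^+ m != 0)%R by rewrite expf_neq0// gt_eqF.
rewrite exprVn -!exprM ![(_ * m)%N]mulnC !exprM.
by field.
Qed.

(** The blocks from M on form a covering, with s-sum at most the tail of a
    convergent geometric series; M is also taken large enough for the discs to
    have diameter at most delta. *)
Lemma hausdorff_dim_limsup A (c : nat -> nat -> Cplx R) :
    (forall M a, A a -> exists m j, [/\ (M <= m)%N, (j < block_size m)%N &
      (Cmod (a - c m j) <= 4 / 2 ^+ m)%R]) ->
  hausdorff_dim A = 0.
Proof.
move=> Ac.
have content0 (s delta : R) : (0 < s)%R -> (0 < delta)%R ->
    hausdorff_content s delta A = 0.
  move=> s0 delta0; have [D [q [D0 /andP[q0 q1] Dq]]] := block_sum_le s0.
  have term0 U : 0 <= diameter U `^ s by exact: poweR_ge0.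
  apply/eqP; rewrite eq_le; apply/andP; split; last first.
    by apply: le_ereal_inf_tmp => _ [U _ <-]; apply: nneseries_ge0 => k _ _.
  apply/lee_addgt0Pr => eps eps0; rewrite add0r.
  have [M1 M1P] := half_power_small 8 delta0.
  have [M2 M2P] : exists M2, (q ^+ M2 * (D / (1 - q)) < eps)%R.
    have /cvgrPdist_lt/(_ _ eps0)[M2 _ M2P] :=
      @cvg_geometric R (D / (1 - q))%R q ltac:(by rewrite ger0_norm// ltW).
    exists M2; have := M2P M2 (leqnn M2).
    by rewrite /= sub0r normrN mulrC => /(le_lt_trans (ler_norm _)).
  pose M := maxn M1 M2.
  pose V (p : nat * nat) : set (Cplx R) := [set a |
    (p.2 < block_size (M + p.1))%N /\
    (Cmod (a - c (M + p.1)%N p.2) <= 4 / 2 ^+ (M + p.1))%R].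
  have diamV p : diameter (V p) <= (8 / 2 ^+ (M + p.1))%:E.
    have -> : (8 / 2 ^+ (M + p.1) = 2 * (4 / 2 ^+ (M + p.1)) :> R)%R.
      by rewrite mulrA -natrM.
    apply: (@diameter_ball_le _ (c (M + p.1)%N p.2)) => [|a []//].
    by rewrite divr_ge0// exprn_ge0.
  have [e e_bij] : exists e, set_bij [set: nat] [set: nat * nat] e.
    by apply/card_set_bijP; rewrite card_eq_sym; exact: card_nat2.
  apply: (@le_trans _ _ (\sum_(k <oo) diameter (V (e k)) `^ s)).
    apply: ereal_inf_lbound; exists (V \o e) => //; split.
      move=> a /(Ac M)[m [j [Mm jm aj]]].
      have [_ _ /(_ (m - M, j)%N Logic.I)[k _ ek]] := e_bij.
      by exists k => //; rewrite /V /= ek /= subnKC.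
    move=> k /=; apply: le_trans (diamV _) _.
    rewrite lee_fin; apply: le_trans (ltW M1P); rewrite ler_pM2l//.
    rewrite lef_pV2 ?posrE ?exprn_gt0// ler_eXn2l ?ltr1n//.
    by rewrite (leq_trans (leq_maxl M1 M2))// leq_addr.
  rewrite (nneseries_pairs e_bij (u := fun p => diameter (V p) `^ s))//.
  have rowle m : \sum_(j <oo) diameter (V (m, j)) `^ s <= (D * q ^+ (M + m))%:E.
    apply: le_trans (_ : _ <= ((block_size (M + m))%:R * (8 / 2 ^+ (M + m)) `^ s)%:E) _;
      last by rewrite lee_fin Dq.
    apply: nneseries_block_le => //.
    - move=> j _; rewrite -poweR_EFin; apply: gt0_ler_poweR => //.
      + exact: ltW.
      + by rewrite in_itv/= diameter_ge0 leey.
      + by rewrite in_itv/= lee_fin leey andbT divr_ge0// exprn_ge0.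
    - move=> j Nj; have -> : V (m, j) = set0.
        by apply/seteqP; split => // a [] /=; rewrite ltnNge Nj.
      by rewrite diameter_set0 poweR0r// gt_eqF.
  apply: nneseries_le_bound => [m|n]; first by apply: nneseries_ge0 => j _ _.
  apply: (@le_trans _ _ (\sum_(0 <= m < n) (D * q ^+ (M + m))%:E)).
    by apply: lee_sum => m _; exact: rowle.
  rewrite sumEFin lee_fin; apply: le_trans (ltW M2P).
  have q10 : (0 < 1 - q)%R by rewrite subr_gt0.
  have := @geometric_seriesE R (D * q ^+ M)%R q ltac:(by rewrite lt_eqF).
  move=> /(congr1 (fun f : nat -> R => f n)) /= geoE.
  rewrite (_ : (\sum_(0 <= m < n) D * q ^+ (M + m) =
      D * q ^+ M * (1 - q ^+ n) / (1 - q))%R); last first.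
    by rewrite -geoE /series /=; apply: eq_bigr => m _; rewrite exprD mulrA.
  have -> : (D * q ^+ M * (1 - q ^+ n) / (1 - q) =
      q ^+ M * (D / (1 - q)) * (1 - q ^+ n))%R by ring.
  have Dq0 : (0 <= D / (1 - q))%R by rewrite divr_ge0// ltW.
  apply: (@le_trans _ _ (q ^+ M * (D / (1 - q)))%R).
    have q0' := ltW q0; apply: ler_piMr; first by rewrite mulr_ge0// exprn_ge0.
    by rewrite gerBl exprn_ge0.
  apply: ler_wpM2r => //; apply: ler_wiXn2l; [exact: ltW|exact: ltW|].
  exact: leq_maxr.
apply/eqP; rewrite eq_le; apply/andP; split; last first.
  by apply: le_ereal_inf_tmp => _ [s [s0 _] <-]; rewrite lee_fin ltW.
apply/lee_addgt0Pr => s s0; rewrite add0r; apply: ereal_inf_lbound.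
exists s => //; split => //; rewrite /hausdorff_measure.
rewrite (_ : [set _ | _ in _] = [set 0]) ?ereal_sup1//.
apply/seteqP; split => [_ [d d0 <-]|_ ->]; first exact: content0.
by exists 1%R => //=; rewrite content0.
Qed.
End Covering.

(** * Conclusion *)

(** A list of maximal length contains everything. *)
Lemma bounded_enumeration (T : eqType) (P : T -> Prop) (N : nat) :
    (forall s, uniq s -> (forall x, x \in s -> P x) -> (size s <= N)%N) ->
  exists2 s : seq T, (size s <= N)%N & forall x, P x -> x \in s.
Proof.
move=> PN.
pose Q k := `[< exists s, [/\ uniq s, forall x, x \in s -> P x & size s = k] >].
have Q0 : exists k, Q k by exists 0%N; apply/asboolP; exists [::].
have QN k : Q k -> (k <= N)%N by move=> /asboolP[s [us sP <-]]; exact: PN.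
have [k /asboolP[s [us sP sk]] kmax] := ex_maxnP Q0 QN.
exists s; first exact: PN.
move=> x Px; apply: contraT => xs.
suff /kmax : Q k.+1 by rewrite ltnn.
apply/asboolP; exists (x :: s); split; rewrite /= ?xs ?sk// => y.
by rewrite inE => /predU1P[->|/sP].
Qed.

(** The centres of block m are the directions of the points of modulus at most
    2^m where F takes the value F(0) + 1. *)
Lemma slow_growth_directions (R : realType) (F : entire_space R) :
    (forall z, Cmod (F z) <= slow_growth (Cmod z)) ->
  hausdorff_dim (hypercyclic_directions F) = 0%E.
Proof.
move=> Fphi.
have /choice[s sP] (m : nat) : exists s : seq (Cplx R), (0 < m)%N ->
    (size s <= block_size m)%N /\
    forall z, F z = F 0 + 1 /\ Cmod z <= 2 ^+ m -> z \in s.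
  have [->|m0] := posnP m; first by exists [::].
  have [s us sP|s sN sP] := @bounded_enumeration _
      (fun z : Cplx R => F z = F 0 + 1 /\ Cmod z <= 2 ^+ m) (block_size m).
    apply: (@zero_count R F s m) => //; first exact: entire_derivable.
      by move=> z /sP[].
    by move=> z /sP[].
  by exists s.
apply: (@hausdorff_dim_limsup R _
  (fun m j => let z := nth 0 (s m) j in z / `|z|)) => M a [a1 Fa].
have [z [n [Fz Mz zn]]] := hypercyclic_value (2 ^ M.+1)%N a1 Fphi Fa.
have z0 : z != 0.
  by rewrite -Cmod_gt0 (lt_le_trans _ Mz)// ltr0n expn_gt0.
have ex_m : exists m, Cmod z <= 2 ^+ m.
  have [m] := half_power_small (Cmod z) ltr01.
  by rewrite ltr_pdivrMr ?exprn_gt0// mul1r => /ltW; exists m.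
have [m zm m_min] := ex_minnP ex_m.
have Mm : (M < m)%N.
  by have := le_trans Mz zm; rewrite natrX ler_eXn2l ?ltr1n.
have m0 : (0 < m)%N by exact: leq_ltn_trans Mm.
have [sm smP] := sP m m0; have zs : z \in s m by apply: smP.
exists m, (index z (s m)); split; first exact: ltnW.
  by apply: leq_trans sm; rewrite index_mem.
rewrite /= nth_index//; apply: le_trans (hypercyclic_direction a1 z0 zn) _.
have zm1 : 2 ^+ m.-1 < Cmod z.
  by rewrite ltNge; apply/negP => /m_min; rewrite -ltnS prednK// ltnn.
have -> : 4 / 2 ^+ m = 2 / 2 ^+ m.-1 :> R.
  by rewrite -{1}(prednK m0) exprS; field; rewrite expf_neq0.
by rewrite ler_pM2l// lef_pV2 ?ltW// posrE ?exprn_gt0// Cmod_gt0.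
Qed.

Theorem theoremD (R : realType) :
  exists phi : R -> R, transcendental_growth phi /\
    forall F : entire_space R,
      (forall z : Cplx R, Cmod (F z) <= phi (Cmod z)) ->
      hausdorff_dim (hypercyclic_directions F) = 0%E.
Proof.
exists (@slow_growth R); split; last exact: slow_growth_directions.
exists (@slow_coef R); split.
- exact: slow_coef_gt0.
- exact: slow_coef_ratio.
- exact: slow_growth_cvg.
Qed.
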